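(* Let $q_0(x) = x + O(x^2)$ and $q_1(x) = O(x)$ (as $x \to 0$) be arbitrary smooth functions. Then the relations $$q_2 q_0 = 3 q_1^2 - q_0' + 1, \qquad q_3 q_0^2 = q_1^3 - q_1' q_0 + q_1$$ uniquely determine smooth functions $q_2(x)$ and $q_3(x)$ (near $x=0$), which are analytic if $q_0$ and $q_1$ are analytic. Moreover, each system $$\dot x = -y, \qquad \dot y = q_0(x) + 3 q_1(x) y + q_2(x) y^2 + q_3(x) y^3$$ with these coefficients has an isochronous center at the origin.
   Context: Smooth means $C^\infty$, and functions are real-valued and considered on a neighborhood of $x=0$ (in which $x=0$ is the only zero of $q_0$). Primes denote derivatives in $x$. A singular point of a planar system is a center if some punctured neighborhood of it is filled with closed orbits (cycles) surrounding it. A center is isochronous if all cycles near it have the same period. *)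

(* Defs.v *)
From Stdlib Require Import Reals.
From Coquelicot Require Import Coquelicot.
Open Scope R_scope.

Definition smooth_on (D : R -> Prop) (f : R -> R) : Prop :=
  forall x, D x -> forall n, ex_derive_n f n x.

Definition analytic_at (f : R -> R) (a : R) : Prop :=
  exists c : nat -> R, locally a (fun x => is_pseries c (x - a) (f x)).

Definition analytic_on (D : R -> Prop) (f : R -> R) : Prop :=
  forall a, D a -> analytic_at f a.

(* f = O(g) as x -> 0.  Coquelicot's [is_domin] is the little-o relation. *)
Definition bigO_at0 (f g : R -> R) : Prop :=
  exists C : R, locally 0 (fun x => Rabs (f x) <= C * Rabs (g x)).

Definition connected (C : R * R -> Prop) : Prop :=
  forall A B : R * R -> Prop,
    open A -> open B ->
    (forall z, C z -> A z \/ B z) ->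
    (forall z, C z -> ~ (A z /\ B z)) ->
    (forall z, C z -> A z) \/ (forall z, C z -> B z).

Definition connected_component (S : R * R -> Prop) (p z : R * R) : Prop :=
  exists C : R * R -> Prop,
    connected C /\ (forall w, C w -> S w) /\ C p /\ C z.

Definition bounded_set (S : R * R -> Prop) : Prop :=
  exists M : R, forall z, S z -> norm z <= M.

(* For a Jordan curve gamma: p lies in its interior, the bounded component of
   the complement.  The first conjunct is needed because the component of p
   is empty when p is on the curve. *)
Definition surrounds (gamma : R -> R * R) (p : R * R) : Prop :=
  (forall t, gamma t <> p) /\
  bounded_set (connected_component (fun z => forall t, gamma t <> z) p).

Definition periodic (gamma : R -> R * R) (T : R) : Prop :=
  0 < T /\ forall t, gamma (t + T) = gamma t.

Definition least_period (gamma : R -> R * R) (T : R) : Prop :=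
  periodic gamma T /\ forall S, periodic gamma S -> T <= S.

(* The system z' = V z is considered on the region U only: V may take
   arbitrary values outside U. *)
Definition solution (U : R * R -> Prop) (V : R * R -> R * R)
    (gamma : R -> R * R) : Prop :=
  forall t, U (gamma t) /\ is_derive gamma t (V (gamma t)).

(* A constant solution has no least period, so it is not a cycle. *)
Definition cycle (U : R * R -> Prop) (V : R * R -> R * R)
    (gamma : R -> R * R) (T : R) : Prop :=
  solution U V gamma /\ least_period gamma T.

Definition is_center (U : R * R -> Prop) (V : R * R -> R * R)
    (p : R * R) : Prop :=
  U p /\ V p = (0, 0) /\
  exists N : R * R -> Prop, locally p N /\
    forall z, N z -> z <> p ->
      exists (gamma : R -> R * R) (T : R),
        cycle U V gamma T /\ (exists t, gamma t = z) /\
        (forall t, N (gamma t)) /\ surrounds gamma p.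

Definition isochronous_center (U : R * R -> Prop) (V : R * R -> R * R)
    (p : R * R) : Prop :=
  is_center U V p /\
  exists (N : R * R -> Prop) (T : R), locally p N /\
    forall (gamma : R -> R * R) (S : R),
      cycle U V gamma S -> (forall t, N (gamma t)) -> S = T.

Definition cubic_field (q0 q1 q2 q3 : R -> R) (z : R * R) : R * R :=
  let (x, y) := z in
  (- y, q0 x + 3 * q1 x * y + q2 x * y ^ 2 + q3 x * y ^ 3).

Definition relations_on (D : R -> Prop) (q0 q1 q2 q3 : R -> R) : Prop :=
  forall x, D x ->
    q2 x * q0 x = 3 * q1 x ^ 2 - Derive q0 x + 1 /\
    q3 x * q0 x ^ 2 = q1 x ^ 3 - Derive q1 x * q0 x + q1 x.

(* Main.v *)
(** Put h = q1/q0 and p = (1 - q0')/q0, which are smooth because the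
    numerators vanish at 0; the relations become
    q2 = 3 h^2 q0 + p and q3 = h^3 q0 - h' + h p.
    Let k = exp (int_0^x p), g = q0 k (so that g' = k) and H = int_0^x h.  In the
    coordinates u = g(x), v = k(x) y / (1 + h(x) y) the system reads
    u' = -(1 + h y) v, v' = (1 + h y) u, and since x' = -y, rotating (u, v) by
    the angle H(x) gives U' = -V, V' = U.  Hence the orbits are the level curves
    of u^2 + v^2 and all have period 2 pi. *)

Require Import Defs.
From Stdlib Require Import Reals.
From Coquelicot Require Import Coquelicot.
From Stdlib Require Import Lra Lia Arith Ranalysis5.
From Stdlib Require Import FunctionalExtensionality Classical ClassicalEpsilon.
Open Scope R_scope.

(** * Smooth functions *)

(** The factor 1 + h y is the angular speed of (u, v), which varies along an orbit. The time
    derivative of H(x) is -h y, so adding H(x) to the angle brings the speed to exactly 1. The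
    rotated pair is injective only near the origin: its rotation angle depends on x, and the growth
    of g has to dominate the variation of H. This injectivity is what carries the period of a
    rotation over to the orbit itself. Exhibiting a cycle through every nearby point uses no
    existence theorem for differential equations. Each level curve is written down with an angle as
    parameter, time is an explicit increasing function of that angle, and inverting it gives the
    solution. That the curve surrounds the origin follows from a separation by energy, without the
    Jordan curve theorem. Division by q0 reduces to division by x, because q0(x)/x has no zero. For
    smooth functions this division is an integral formula; for analytic ones it is a shift of
    coefficients together with reciprocals of power series. *)

Fixpoint diff_n (n : nat) (D : R -> Prop) (f : R -> R) : Prop :=
  match n with
  | O => True
  | S m => (forall x, D x -> ex_derive f x) /\ diff_n m D (Derive f)
  end.

(** [ex_derive_n] differentiates an iterated derivative once more on the outside, whereas [diff_n]
    peels off the innermost derivative. The latter lets an induction on the order, with the function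
    generalized, pass from [f] to [Derive f], as the product and reciprocal rules require. *)
Lemma smooth_on_diff_n (D : R -> Prop) (f : R -> R) :
  smooth_on D f <-> forall n, diff_n n D f.
Proof.
  assert (key : forall n g, diff_n n D g <->
    forall k, (k <= n)%nat -> forall x, D x -> ex_derive_n g k x).
  { induction n as [|n IH]; intros g; simpl.
    - split; [|easy].
      intros _ k Hk x Hx. replace k with 0%nat by lia. exact I.
    - rewrite IH. split.
      + intros [H1 H2] [|k] Hk x Hx; [exact I|].
        destruct k as [|k]; [exact (H1 x Hx)|].
        apply ex_derive_ext with (2 := H2 (S k) ltac:(lia) x Hx). intros t.
        rewrite <- (Nat.add_1_r k). exact (Derive_n_comp g k 1 t).
      + intros H. split.
        * intros x Hx. exact (H 1%nat ltac:(lia) x Hx).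
        * intros [|k] Hk x Hx; [exact I|].
          apply ex_derive_ext with (2 := H (S (S k)) ltac:(lia) x Hx).
          intros t. rewrite <- (Nat.add_1_r k). symmetry.
          exact (Derive_n_comp g k 1 t). }
  split.
  - intros H n. apply key. intros k _ x Hx. now apply H.
  - intros H x Hx n. exact (proj1 (key n f) (H n) n (le_n n) x Hx).
Qed.

Lemma diff_n_ext (n : nat) (D : R -> Prop) (f g : R -> R) :
  open D -> (forall x, D x -> f x = g x) -> diff_n n D f -> diff_n n D g.
Proof.
  intros HD. revert f g. induction n as [|n IH]; intros f g Hfg; simpl; [easy|].
  intros [H1 H2].
  assert (Hl : forall x, D x -> locally x (fun t => f t = g t)).
  { intros x Hx. generalize (HD x Hx). apply filter_imp. exact Hfg. }
  split.
  - intros x Hx. apply ex_derive_ext_loc with (1 := Hl x Hx). now apply H1.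
  - apply IH with (2 := H2). intros x Hx. apply Derive_ext_loc. now apply Hl.
Qed.

Lemma diff_n_pred (n : nat) (D : R -> Prop) (f : R -> R) :
  diff_n (S n) D f -> diff_n n D f.
Proof.
  revert f. induction n as [|n IH]; intros f; [easy|].
  intros [H1 H2]. split; [exact H1|]. now apply IH.
Qed.

Lemma diff_n_const (n : nat) (D : R -> Prop) (c : R) : diff_n n D (fun _ => c).
Proof.
  revert c. induction n as [|n IH]; intros c; [easy|]. split.
  - intros x _. apply ex_derive_const.
  - replace (Derive (fun _ => c)) with (fun _ : R => 0); [apply IH|].
    apply functional_extensionality.
    intros x. symmetry. apply Derive_const.
Qed.

Lemma diff_n_id (n : nat) (D : R -> Prop) : diff_n n D (fun x => x).
Proof.
  destruct n as [|n]; [easy|]. split.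
  - intros x _. apply ex_derive_id.
  - replace (Derive (fun x => x)) with (fun _ : R => 1); [apply diff_n_const|].
    apply functional_extensionality.
    intros x. now rewrite Derive_id.
Qed.

Lemma diff_n_plus (n : nat) (D : R -> Prop) (f g : R -> R) :
  open D -> diff_n n D f -> diff_n n D g -> diff_n n D (fun x => f x + g x).
Proof.
  intros HD. revert f g.
  induction n as [|n IH]; intros f g; [easy|]. intros [F1 F2] [G1 G2]. split.
  - intros x Hx. apply @ex_derive_plus; auto.
  - apply diff_n_ext with (f := fun x => Derive f x + Derive g x); auto.
    intros x Hx. rewrite Derive_plus; auto.
Qed.

Lemma diff_n_mult (n : nat) (D : R -> Prop) (f g : R -> R) :
  open D -> diff_n n D f -> diff_n n D g -> diff_n n D (fun x => f x * g x).
Proof.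
  intros HD. revert f g.
  induction n as [|n IH]; intros f g; [easy|]. intros Hf Hg.
  pose proof (diff_n_pred _ _ _ Hf). pose proof (diff_n_pred _ _ _ Hg).
  destruct Hf as [F1 F2]. destruct Hg as [G1 G2]. split.
  - intros x Hx. apply ex_derive_mult; auto.
  - apply diff_n_ext with
      (f := fun x => Derive f x * g x + f x * Derive g x); auto.
    + intros x Hx. rewrite Derive_mult; auto.
    + apply diff_n_plus; auto.
Qed.

Lemma diff_n_inv (n : nat) (D : R -> Prop) (f : R -> R) :
  open D -> (forall x, D x -> f x <> 0) ->
  diff_n n D f -> diff_n n D (fun x => / f x).
Proof.
  intros HD Hf0.
  induction n as [|n IH]; [easy|]. intros Hf.
  pose proof (IH (diff_n_pred _ _ _ Hf)) as Hi.
  destruct Hf as [F1 F2]. split.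
  - intros x Hx. apply ex_derive_inv; auto.
  - apply diff_n_ext with
      (f := fun x => (-1) * (Derive f x * (/ f x * / f x))); auto.
    + intros x Hx. rewrite Derive_inv; auto. field. auto.
    + repeat apply diff_n_mult; auto. apply diff_n_const.
Qed.

Section SmoothAlgebra.
Context (D : R -> Prop) (D_open : open D).

Lemma smooth_on_ext (f g : R -> R) :
  (forall x, D x -> f x = g x) -> smooth_on D f -> smooth_on D g.
Proof.
  rewrite !smooth_on_diff_n. intros H Hf n. eapply diff_n_ext; eauto.
Qed.

Lemma smooth_on_ex_derive (f : R -> R) (x : R) :
  smooth_on D f -> D x -> ex_derive f x.
Proof. intros H Hx. exact (H x Hx 1%nat). Qed.

Lemma smooth_on_continuous (f : R -> R) (x : R) :
  smooth_on D f -> D x -> continuous f x.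
Proof.
  intros H Hx. apply @ex_derive_continuous. now apply smooth_on_ex_derive.
Qed.

Lemma smooth_on_Derive (f : R -> R) : smooth_on D f -> smooth_on D (Derive f).
Proof. rewrite !smooth_on_diff_n. intros H n. exact (proj2 (H (S n))). Qed.

Lemma smooth_on_const (c : R) : smooth_on D (fun _ => c).
Proof. rewrite smooth_on_diff_n. intros n. apply diff_n_const. Qed.

Lemma smooth_on_id : smooth_on D (fun x => x).
Proof. rewrite smooth_on_diff_n. intros n. apply diff_n_id. Qed.

Lemma smooth_on_plus (f g : R -> R) :
  smooth_on D f -> smooth_on D g -> smooth_on D (fun x => f x + g x).
Proof. rewrite !smooth_on_diff_n. intros Hf Hg n. now apply diff_n_plus. Qed.

Lemma smooth_on_mult (f g : R -> R) :
  smooth_on D f -> smooth_on D g -> smooth_on D (fun x => f x * g x).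
Proof. rewrite !smooth_on_diff_n. intros Hf Hg n. now apply diff_n_mult. Qed.

Lemma smooth_on_opp (f : R -> R) :
  smooth_on D f -> smooth_on D (fun x => - f x).
Proof.
  intros Hf. apply smooth_on_ext with (fun x => (-1) * f x).
  - intros x _. ring.
  - apply smooth_on_mult; [apply smooth_on_const | exact Hf].
Qed.

Lemma smooth_on_minus (f g : R -> R) :
  smooth_on D f -> smooth_on D g -> smooth_on D (fun x => f x - g x).
Proof. intros Hf Hg. apply smooth_on_plus; [|apply smooth_on_opp]; easy. Qed.

Lemma smooth_on_inv (f : R -> R) :
  (forall x, D x -> f x <> 0) -> smooth_on D f -> smooth_on D (fun x => / f x).
Proof. rewrite !smooth_on_diff_n. intros H0 Hf n. now apply diff_n_inv. Qed.

End SmoothAlgebra.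

(** * Division by x of a smooth function vanishing at 0 *)

Lemma locally_ball0 (D : R -> Prop) :
  open D -> D 0 -> exists d, 0 < d /\ forall x, Rabs x < d -> D x.
Proof.
  intros HD H0. destruct (HD 0 H0) as [d Hd]. exists d. split; [apply cond_pos|].
  intros x Hx. apply Hd. change (Rabs (x - 0) < d). now rewrite Rminus_0_r.
Qed.

Lemma open_Rabs_lt (d : R) : open (fun x : R => Rabs x < d).
Proof.
  apply (open_comp Rabs (fun y => y < d)).
  - intros x _. apply continuous_Rabs.
  - apply open_lt.
Qed.

Lemma Rabs_mult_unit_lt (d s x : R) :
  0 <= s <= 1 -> Rabs x < d -> Rabs (x * s) < d.
Proof.
  intros Hs Hx. rewrite Rabs_mult, (Rabs_pos_eq s) by lra.
  pose proof (Rabs_pos x). nra.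
Qed.

(** Differentiation under the integral sign. Each derivative in x produces one more factor s, so the
    power s ^ n is carried along to make the statement iterable. *)
Lemma is_derive_RInt_dilation (d : R) (f : R -> R) (n : nat) (x : R) :
  smooth_on (fun x => Rabs x < d) f -> Rabs x < d ->
  is_derive (fun x => RInt (fun s => s ^ n * f (x * s)) 0 1) x
    (RInt (fun s => s ^ S n * Derive f (x * s)) 0 1).
Proof.
  intros Hf Hx. set (B := fun x => Rabs x < d) in *.
  assert (HB : open B) by apply open_Rabs_lt.
  assert (Hloc : locally x B) by now apply HB.
  assert (Hder : forall u s, B (u * s) ->
    is_derive (fun u => s ^ n * f (u * s)) u (s ^ S n * Derive f (u * s))).
  { intros u s Hu. auto_derive.
    - exact (smooth_on_ex_derive B f _ Hf Hu).
    - change (Derive (fun x => f x)) with (Derive f). simpl. ring. }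
  assert (Hcont : forall u s, 0 <= s <= 1 -> B u ->
    continuous (fun s => s ^ n * f (u * s)) s).
  { intros u s Hs Hu. apply @ex_derive_continuous. auto_derive.
    apply (smooth_on_ex_derive B); [exact Hf|].
    now apply Rabs_mult_unit_lt. }
  erewrite RInt_ext; [apply is_derive_RInt_param|].
  - generalize Hloc. apply filter_imp. intros u Hu s Hs.
    rewrite Rmin_left, Rmax_right in Hs by lra.
    eexists. apply Hder. now apply Rabs_mult_unit_lt.
  - intros s Hs. rewrite Rmin_left, Rmax_right in Hs by lra.
    (* The partial derivative has its closed form only where u * v lies in the ball; this holds near
       (x, s) because the ball is open. *)
    apply continuity_2d_pt_ext_loc with
      (fun u v => v ^ S n * Derive f (u * v)).
    + assert (Hc : continuity_2d_pt (fun u v => u * v) x s).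
      { apply continuity_2d_pt_mult;
          [apply continuity_2d_pt_id1 | apply continuity_2d_pt_id2]. }
      assert (Hxs : B (x * s)) by now apply Rabs_mult_unit_lt.
      destruct (HB _ Hxs) as [e He]. destruct (Hc e) as [e' He'].
      exists e'. intros u v Hu Hv. symmetry. apply is_derive_unique.
      apply Hder. apply He. now apply He'.
    + apply continuity_2d_pt_mult.
      * apply (continuity_1d_2d_pt_comp (fun v => v ^ S n) (fun _ v => v)).
        -- apply derivable_continuous_pt, derivable_pt_pow.
        -- apply continuity_2d_pt_id2.
      * apply (continuity_1d_2d_pt_comp (Derive f) (fun u v => u * v)).
        -- apply continuity_pt_filterlim.
           apply (smooth_on_continuous B).
           ++ now apply smooth_on_Derive.
           ++ now apply Rabs_mult_unit_lt.
        -- apply continuity_2d_pt_mult;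
             [apply continuity_2d_pt_id1 | apply continuity_2d_pt_id2].
  - generalize Hloc. apply filter_imp. intros u Hu.
    apply @ex_RInt_continuous. intros s Hs.
    rewrite Rmin_left, Rmax_right in Hs by lra. now apply Hcont.
  - intros s Hs. rewrite Rmin_left, Rmax_right in Hs by lra. symmetry.
    apply is_derive_unique, Hder. apply Rabs_mult_unit_lt; [lra|easy].
Qed.

Lemma smooth_on_RInt_dilation (d : R) (f : R -> R) (n : nat) :
  smooth_on (fun x => Rabs x < d) f ->
  smooth_on (fun x => Rabs x < d)
    (fun x => RInt (fun s => s ^ n * f (x * s)) 0 1).
Proof.
  intros Hf. apply smooth_on_diff_n. intros m. revert f n Hf.
  induction m as [|m IH]; intros f n Hf; [easy|]. split.
  - intros x Hx. eexists. now apply (is_derive_RInt_dilation d).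
  - apply diff_n_ext with
      (fun x => RInt (fun s => s ^ S n * Derive f (x * s)) 0 1).
    + apply open_Rabs_lt.
    + intros x Hx. symmetry. apply is_derive_unique.
      now apply (is_derive_RInt_dilation d).
    + apply IH. apply smooth_on_Derive; easy.
Qed.

(** The integrand times x is the derivative of f (x * s) in s. The factor s ^ 0 keeps the shape of
    the preceding lemmas. *)
Lemma RInt_Derive_dilation (d : R) (f : R -> R) (x : R) :
  smooth_on (fun x => Rabs x < d) f -> Rabs x < d ->
  x * RInt (fun s => s ^ 0 * Derive f (x * s)) 0 1 = f x - f 0.
Proof.
  intros Hf Hx. set (B := fun x => Rabs x < d) in *.
  assert (HB : open B) by apply open_Rabs_lt.
  assert (Hc : forall g s, smooth_on B g -> 0 <= s <= 1 ->
    ex_derive (fun s => g (x * s)) s).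
  { intros g s Hg Hs. auto_derive.
    apply (smooth_on_ex_derive B); [exact Hg|]. now apply Rabs_mult_unit_lt. }
  assert (HI : is_RInt (fun s => x * (s ^ 0 * Derive f (x * s))) 0 1
    (f (x * 1) - f (x * 0))).
  { apply @is_RInt_derive with (f := fun s => f (x * s)).
    - intros s Hs. rewrite Rmin_left, Rmax_right in Hs by lra.
      evar_last.
      + apply Derive_correct. now apply Hc.
      + rewrite (Derive_comp f (fun s => x * s)).
        * rewrite Derive_scal, Derive_id. simpl. ring.
        * apply (smooth_on_ex_derive B); [exact Hf|].
          now apply Rabs_mult_unit_lt.
        * auto_derive. easy.
    - intros s Hs. rewrite Rmin_left, Rmax_right in Hs by lra.
      apply @ex_derive_continuous. apply @ex_derive_ext with
        (fun s => x * Derive f (x * s)).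
      + intros t. simpl. ring.
      + apply @ex_derive_scal. apply Hc; [now apply smooth_on_Derive|easy]. }
  apply (@is_RInt_unique R_CompleteNormedModule) in HI.
  rewrite Rmult_1_r, Rmult_0_r in HI.
  rewrite <- HI. symmetry.
  apply (RInt_scal (fun s => s ^ 0 * Derive f (x * s)) 0 1 x).
  apply @ex_RInt_continuous. intros s Hs.
  rewrite Rmin_left, Rmax_right in Hs by lra.
  apply @ex_derive_continuous. apply @ex_derive_ext with
    (fun s => Derive f (x * s)).
  - intros t. simpl. ring.
  - apply Hc; [now apply smooth_on_Derive|easy].
Qed.

(** Hadamard's lemma: near 0 the quotient is the integral of f' (x s) over s in [0, 1], which is
    smooth in x. *)
Lemma smooth_on_div_id (D : R -> Prop) (f : R -> R) :
  open D -> D 0 -> smooth_on D f -> f 0 = 0 ->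
  exists phi, smooth_on D phi /\ forall x, f x = x * phi x.
Proof.
  intros HD H0 Hf Hf0. destruct (locally_ball0 D HD H0) as [d [Hd HdD]].
  assert (HfB : smooth_on (fun x => Rabs x < d) f).
  { intros x Hx. apply Hf. now apply HdD. }
  set (J := fun x => RInt (fun s => s ^ 0 * Derive f (x * s)) 0 1).
  (* [D] need not contain the segment from 0 to x, so the integral [J] is reliable only on a ball
     around 0. Elsewhere the plain quotient is used, and on the ball the two agree. *)
  exists (fun x => if Req_EM_T x 0 then J x else f x / x).
  split.
  - intros x Hx n. destruct (Req_dec x 0) as [->|Hx0].
    + apply ex_derive_n_ext_loc with J.
      * generalize (open_Rabs_lt d 0 ltac:(cbv beta; now rewrite Rabs_R0)).
        apply filter_imp. intros t Ht.
        destruct (Req_EM_T t 0) as [->|Ht0]; [easy|].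
        apply Rmult_eq_reg_l with t; [|easy]. unfold J.
        rewrite (RInt_Derive_dilation d f t HfB Ht).
        rewrite Hf0. now field.
      * apply (smooth_on_RInt_dilation d (Derive f) 0).
        -- now apply smooth_on_Derive.
        -- now rewrite Rabs_R0.
    + set (E := fun x => D x /\ x <> 0).
      assert (HE : open E) by (apply open_and; [easy | apply open_neq]).
      assert (HEx : E x) by easy.
      apply ex_derive_n_ext_loc with (fun x => f x * / x).
      * generalize (HE x HEx). apply filter_imp. intros t [_ Ht].
        now destruct (Req_EM_T t 0).
      * apply (smooth_on_mult E HE f (fun x => / x)); [| |easy].
        -- intros t [Ht _]. now apply Hf.
        -- apply (smooth_on_inv E HE (fun x => x)); [now intros t [_ Ht]|].
           now apply smooth_on_id.
  - intros x. destruct (Req_EM_T x 0) as [->|Hx]; [rewrite Hf0; ring|].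
    now field.
Qed.

(** * Analytic functions *)

(** The series converges at the nonzero point d / 2, so its terms tend to 0 there, which is
    impossible outside the disk of convergence. *)
Lemma is_pseries_CV_radius_pos (c : nat -> R) (a : R) (f : R -> R) :
  locally a (fun x => is_pseries c (x - a) (f x)) ->
  Rbar_lt 0 (CV_radius c).
Proof.
  intros [d Hd]. pose proof (cond_pos d) as Hpos.
  assert (Hx : is_pseries c (d / 2) (f (a + d / 2))).
  { replace (d / 2) with (a + d / 2 - a) at 1 by ring. apply Hd.
    change (Rabs (a + d / 2 - a) < d).
    replace (a + d / 2 - a) with (d / 2) by ring.
    rewrite Rabs_pos_eq; lra. }
  apply Rbar_lt_le_trans with (Rabs (d / 2)).
  { simpl. apply Rabs_pos_lt. lra. }
  apply Rbar_not_lt_le. intros Hlt.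
  apply (CV_disk_outside _ _ Hlt).
  apply is_lim_seq_ext with (fun n => scal (pow_n (d / 2) n) (c n)).
  { intros n. rewrite pow_n_pow. apply Rmult_comm. }
  apply ex_series_lim_0. eexists. exact Hx.
Qed.

Lemma locally_Rabs_lt_CV_radius (c : nat -> R) (a : R) :
  Rbar_lt 0 (CV_radius c) ->
  locally a (fun x => Rbar_lt (Rabs (x - a)) (CV_radius c)).
Proof.
  intros Hc.
  assert (exists r : posreal, Rbar_le r (CV_radius c)) as [r Hr].
  { destruct (CV_radius c) as [l| |]; simpl in Hc;
      [|now exists (mkposreal 1 Rlt_0_1)|easy].
    exists (mkposreal l Hc). simpl. lra. }
  exists r. intros x Hx. apply Rbar_lt_le_trans with r; [exact Hx|exact Hr].
Qed.

Lemma analytic_at_PSeries (f : R -> R) (a : R) :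
  analytic_at f a ->
  exists c, Rbar_lt 0 (CV_radius c) /\
    locally a (fun x => f x = PSeries c (x - a)).
Proof.
  intros [c Hc]. exists c. split.
  - now apply is_pseries_CV_radius_pos with a f.
  - generalize Hc. apply filter_imp. intros x Hx. symmetry.
    now apply is_pseries_unique.
Qed.

Lemma PSeries_analytic_at (c : nat -> R) (f : R -> R) (a : R) :
  Rbar_lt 0 (CV_radius c) ->
  locally a (fun x => f x = PSeries c (x - a)) ->
  analytic_at f a.
Proof.
  intros Hc Hf. exists c.
  generalize (filter_and _ _ (locally_Rabs_lt_CV_radius c a Hc) Hf).
  apply filter_imp. intros x [H1 ->]. apply PSeries_correct.
  now apply CV_radius_inside.
Qed.

Lemma analytic_at_ext_loc (f g : R -> R) (a : R) :
  locally a (fun x => f x = g x) -> analytic_at f a -> analytic_at g a.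
Proof.
  intros H [c Hc]. exists c. generalize (filter_and _ _ H Hc).
  apply filter_imp. intros x [E Hx]. now rewrite <- E.
Qed.

(** Covers constants and the identity at once, hence the shapes [3 + 0 * x] and [0 + 1 * x] further
    on. The partial sums are stationary from index 1. *)
Lemma analytic_at_affine (u v a : R) : analytic_at (fun x => u + v * x) a.
Proof.
  set (c := fun n => match n with O => u + v * a | 1%nat => v | _ => 0 end).
  exists c. apply filter_forall. intros x.
  replace (u + v * x) with (sum_n (fun k => scal (pow_n (x - a) k) (c k)) 1).
  - apply filterlim_ext_loc with (f := fun _ : nat =>
      sum_n (fun k => scal (pow_n (x - a) k) (c k)) 1);
      [|apply filterlim_const].
    exists 1%nat. intros n Hn. induction Hn as [|n Hn IH]; [easy|].
    rewrite IH. symmetry. etransitivity; [apply sum_Sn|].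
    rewrite <- plus_zero_r. f_equal.
    destruct n as [|n]; [lia|]. apply Rmult_0_r.
  - rewrite sum_Sn, sum_O. simpl.
    change (1 * (u + v * a) + (x - a) * 1 * v = u + v * x). ring.
Qed.

Lemma analytic_at_plus (f g : R -> R) (a : R) :
  analytic_at f a -> analytic_at g a -> analytic_at (fun x => f x + g x) a.
Proof.
  intros [c Hc] [d Hd]. exists (PS_plus c d).
  generalize (filter_and _ _ Hc Hd). apply filter_imp. intros x [H1 H2].
  exact (is_pseries_plus _ _ _ _ _ H1 H2).
Qed.

Lemma analytic_at_mult (f g : R -> R) (a : R) :
  analytic_at f a -> analytic_at g a -> analytic_at (fun x => f x * g x) a.
Proof.
  intros [c Hc] [d Hd]. exists (PS_mult c d).
  generalize
    (filter_and _ _ (filter_and _ _ Hc Hd) (filter_and _ _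
      (locally_Rabs_lt_CV_radius c a (is_pseries_CV_radius_pos _ _ _ Hc))
      (locally_Rabs_lt_CV_radius d a (is_pseries_CV_radius_pos _ _ _ Hd)))).
  apply filter_imp. intros x [[H1 H2] [H3 H4]].
  now apply is_pseries_mult.
Qed.

Lemma analytic_at_minus (f g : R -> R) (a : R) :
  analytic_at f a -> analytic_at g a -> analytic_at (fun x => f x - g x) a.
Proof.
  intros Hf Hg.
  apply analytic_at_ext_loc with (fun x => f x + (- 1 + 0 * x) * g x).
  - apply filter_forall. intros x. ring.
  - apply analytic_at_plus, analytic_at_mult; auto using analytic_at_affine.
Qed.

Lemma analytic_at_Derive (f : R -> R) (a : R) :
  analytic_at f a -> analytic_at (Derive f) a.
Proof.
  intros Hf. destruct (analytic_at_PSeries f a Hf) as [c [Hc Hloc]].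
  apply PSeries_analytic_at with (PS_derive c).
  - now rewrite CV_radius_derive.
  - generalize (filter_and _ _ (locally_Rabs_lt_CV_radius c a Hc)
      (locally_locally _ _ Hloc)).
    apply filter_imp. intros x [H1 H2].
    rewrite (Derive_ext_loc _ _ _ H2). apply is_derive_unique.
    evar_last.
    + apply (is_derive_comp (PSeries c) (fun x => x - a)).
      * now apply is_derive_PSeries.
      * auto_derive; [easy|reflexivity].
    + apply (scal_one (V := R_ModuleSpace)).
Qed.

(** * Reciprocals of power series *)

(* Coefficients of the reciprocal series of [d] when [d 0 = 1]; only the entries
   up to [n] are meaningful. *)
Fixpoint recip_upto (d : nat -> R) (n : nat) : nat -> R :=
  match n with
  | O => fun _ => 1
  | S m => fun k =>
      if Nat.leb k m then recip_upto d m k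
      else - sum_f_R0 (fun i => d (S i) * recip_upto d m (m - i)%nat) m
  end.

Definition PS_recip (d : nat -> R) (n : nat) : R := recip_upto d n n.

Lemma recip_upto_PS_recip (d : nat -> R) (n k : nat) :
  (k <= n)%nat -> recip_upto d n k = PS_recip d k.
Proof.
  intros H. induction H as [|n H IH]; [easy|]. simpl.
  destruct (Nat.leb_spec k n); [exact IH|lia].
Qed.

Lemma PS_recip_S (d : nat -> R) (n : nat) :
  PS_recip d (S n) =
  - sum_f_R0 (fun i => d (S i) * PS_recip d (n - i)%nat) n.
Proof.
  unfold PS_recip at 1. cbn [recip_upto].
  destruct (Nat.leb_spec (S n) n); [lia|].
  f_equal. apply sum_eq. intros i Hi. rewrite recip_upto_PS_recip; [easy|lia].
Qed.

Lemma PS_mult_recip (d : nat -> R) (n : nat) :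
  d 0%nat = 1 ->
  PS_mult d (PS_recip d) n = match n with O => 1 | _ => 0 end.
Proof.
  intros H0. unfold PS_mult. destruct n as [|n].
  - simpl. rewrite H0. unfold PS_recip. simpl. ring.
  - rewrite decomp_sum by lia. rewrite H0, Nat.sub_0_r. simpl pred.
    rewrite PS_recip_S. simpl. ring.
Qed.

(** Since K * rho = sigma - rho, this is the factorization of a difference of powers. The value of
    sigma is the one for which the majorant recurrence of the reciprocal coefficients closes. *)
Lemma sum_pow_pow (K rho : R) (n : nat) :
  let sigma := rho * (1 + K) in
  sum_f_R0 (fun i => K * rho ^ S i * sigma ^ (n - i)) n =
  sigma ^ S n - rho ^ S n.
Proof.
  intros sigma. induction n as [|n IH].
  - unfold sigma. simpl. ring.
  - rewrite tech5, Nat.sub_diag.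
    rewrite (sum_eq _ (fun i => K * rho ^ S i * sigma ^ (n - i) * sigma)).
    + rewrite <- scal_sum, IH. unfold sigma. simpl. ring.
    + intros i Hi. replace (S n - i)%nat with (S (n - i)) by lia.
      simpl. ring.
Qed.

(** Strong induction: inserting the bounds into the recurrence gives sigma ^ S n - rho ^ S n with
    sigma = rho * (1 + K), which is below sigma ^ S n. *)
Lemma PS_recip_bound (d : nat -> R) (K rho : R) :
  0 <= K -> 0 < rho -> (forall n, Rabs (d n) <= K * rho ^ n) ->
  forall n, Rabs (PS_recip d n) <= (rho * (1 + K)) ^ n.
Proof.
  intros HK Hr Hd n.
  induction n as [n IH] using (well_founded_induction Nat.lt_wf_0).
  destruct n as [|n].
  - unfold PS_recip. simpl. rewrite Rabs_R1. lra.
  - rewrite PS_recip_S, Rabs_Ropp.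
    apply Rle_trans with (1 := Rsum_abs _ _).
    apply Rle_trans with
      (sum_f_R0 (fun i => K * rho ^ S i * (rho * (1 + K)) ^ (n - i)) n).
    + apply sum_Rle. intros i Hi. rewrite Rabs_mult.
      apply Rmult_le_compat; auto using Rabs_pos. apply IH. lia.
    + rewrite sum_pow_pow. pose proof (pow_lt rho (S n) Hr). lra.
Qed.

(** Cauchy's estimate with rho = 1 / r. If no r > 0 kept c n * r ^ n bounded, the radius of
    convergence would be at most 0. *)
Lemma CV_radius_pos_bound (c : nat -> R) :
  Rbar_lt 0 (CV_radius c) ->
  exists K rho, 0 <= K /\ 0 < rho /\ forall n, Rabs (c n) <= K * rho ^ n.
Proof.
  intros Hc.
  assert (exists r, 0 < r /\ exists M, forall n, Rabs (c n * r ^ n) <= M)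
    as [r [Hr [M HM]]].
  { apply NNPP. intros Hn. apply (Rbar_lt_not_le _ _ Hc).
    apply (proj2 (CV_radius_bounded c)). intros r Hr. simpl.
    apply Rnot_lt_le. intros Hr0. apply Hn. now exists r. }
  exists M, (/ r). repeat split.
  - apply Rle_trans with (2 := HM 0%nat). apply Rabs_pos.
  - now apply Rinv_0_lt_compat.
  - intros n. specialize (HM n). rewrite Rabs_mult in HM.
    rewrite (Rabs_pos_eq (r ^ n)) in HM by (apply pow_le; lra).
    pose proof (pow_lt r n Hr). rewrite pow_inv.
    apply Rmult_le_reg_r with (r ^ n); [easy|].
    rewrite Rmult_assoc, Rinv_l by lra. lra.
Qed.

Lemma CV_radius_PS_recip (d : nat -> R) :
  Rbar_lt 0 (CV_radius d) -> Rbar_lt 0 (CV_radius (PS_recip d)).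
Proof.
  intros Hd. destruct (CV_radius_pos_bound d Hd) as [K [rho [HK [Hr Hb]]]].
  pose proof (PS_recip_bound d K rho HK Hr Hb) as Hrec.
  set (s := rho * (1 + K)) in *.
  assert (Hs : 0 < s) by (unfold s; nra).
  apply Rbar_lt_le_trans with (/ s); [now apply Rinv_0_lt_compat|].
  apply (proj1 (CV_radius_bounded (PS_recip d))). exists 1. intros n.
  pose proof (pow_lt s n Hs).
  rewrite Rabs_mult, pow_inv, (Rabs_pos_eq (/ s ^ n)).
  - apply Rmult_le_reg_r with (s ^ n); [easy|].
    rewrite Rmult_assoc, Rinv_l by lra. specialize (Hrec n). lra.
  - apply Rlt_le. now apply Rinv_0_lt_compat.
Qed.

Lemma PSeries_mult_recip (d : nat -> R) (x : R) :
  d 0%nat = 1 -> Rbar_lt (Rabs x) (CV_radius d) ->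
  Rbar_lt (Rabs x) (CV_radius (PS_recip d)) ->
  PSeries d x * PSeries (PS_recip d) x = 1.
Proof.
  intros H0 H1 H2. rewrite <- PSeries_mult; [|easy|easy].
  rewrite PSeries_decr_1 by now apply ex_pseries_mult.
  rewrite (PSeries_ext _ (fun _ => 0)).
  - rewrite PSeries_const_0, PS_mult_recip by easy. ring.
  - intros n. unfold PS_decr_1. now rewrite PS_mult_recip.
Qed.

Lemma analytic_at_inv (f : R -> R) (a : R) :
  f a <> 0 -> analytic_at f a -> analytic_at (fun x => / f x) a.
Proof.
  intros Hfa Hf. destruct (analytic_at_PSeries f a Hf) as [c [Hc Hloc]].
  assert (Hc0 : c 0%nat = f a).
  { rewrite (locally_singleton _ _ Hloc), Rminus_diag.
    now rewrite PSeries_0. }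
  (* Scaling by 1 / f a makes the constant coefficient 1, as the reciprocal recurrence requires. *)
  set (d := PS_scal (/ f a) c).
  assert (Hd0 : d 0%nat = 1).
  { unfold d, PS_scal. rewrite Hc0. now apply Rinv_l. }
  assert (Hd : Rbar_lt 0 (CV_radius d)).
  { unfold d. rewrite CV_radius_scal; [easy|]. now apply Rinv_neq_0_compat. }
  pose proof (CV_radius_PS_recip d Hd) as Hr.
  apply analytic_at_ext_loc with
    (fun x => (/ f a + 0 * x) * PSeries (PS_recip d) (x - a)).
  - generalize (filter_and _ _ Hloc (filter_and _ _
      (locally_Rabs_lt_CV_radius d a Hd)
      (locally_Rabs_lt_CV_radius (PS_recip d) a Hr))).
    apply filter_imp. intros x [H1 [H2 H3]].
    pose proof (PSeries_mult_recip d (x - a) Hd0 H2 H3) as Hm.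
    unfold d in Hm at 1. rewrite PSeries_scal, <- H1 in Hm.
    (* That f has no zero near a is read off the product identity [Hm], whose right-hand side is
       1. *)
    assert (f x <> 0) by (intros E; rewrite E in Hm; lra).
    rewrite Rmult_0_l, Rplus_0_r.
    apply Rmult_eq_reg_l with (f x); [|easy]. rewrite Rinv_r by easy.
    rewrite <- Hm. ring.
  - apply analytic_at_mult; [apply analytic_at_affine|].
    apply PSeries_analytic_at with (PS_recip d); [easy|].
    now apply filter_forall.
Qed.

(** The filter [at_right a] is proper and never meets a, so along it f and g are eventually equal
    and have the same limit. *)
Lemma continuous_eq_at (f g : R -> R) (a : R) :
  continuous f a -> continuous g a ->
  locally a (fun x => x <> a -> f x = g x) -> f a = g a.
Proof.
  intros Hf Hg H.
  assert (Hle : filter_le (at_right a) (locally a)).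
  { intros P [e He]. exists e. intros y Hy _. now apply He. }
  apply (filterlim_locally_unique (F := at_right a) f).
  - exact (filterlim_filter_le_1 _ Hle Hf).
  - apply filterlim_ext_loc with g.
    + unfold at_right, within. generalize H. apply filter_imp.
      intros x Hx Hxa. symmetry. apply Hx. now apply Rgt_not_eq.
    + exact (filterlim_filter_le_1 _ Hle Hg).
Qed.

(** Dividing by x shifts the coefficients down by one. The equation f x = x * phi x does not see the
    value of phi at 0, which continuity supplies. *)
Lemma analytic_at_div_id (f phi : R -> R) :
  analytic_at f 0 -> (forall x, f x = x * phi x) -> continuous phi 0 ->
  analytic_at phi 0.
Proof.
  intros Hf Hphi Hcont.
  destruct (analytic_at_PSeries f 0 Hf) as [c [Hc Hloc]].
  assert (Hc0 : c 0%nat = 0).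
  { pose proof (locally_singleton _ _ Hloc) as E. cbv beta in E.
    rewrite Hphi, Rminus_0_r, PSeries_0 in E. rewrite <- E. ring. }
  assert (Hc' : Rbar_lt 0 (CV_radius (PS_decr_1 c))).
  { now rewrite CV_radius_decr_1. }
  assert (Hoff : locally 0 (fun x => x <> 0 -> phi x = PSeries (PS_decr_1 c) x)).
  { generalize Hloc. apply filter_imp. intros x Hx Hx0.
    rewrite Hphi, Rminus_0_r, PSeries_decr_1_aux in Hx by easy.
    now apply Rmult_eq_reg_l with x. }
  apply PSeries_analytic_at with (PS_decr_1 c); [easy|].
  generalize Hoff. apply filter_imp. intros x Hx. rewrite Rminus_0_r.
  destruct (Req_dec x 0) as [->|Hx0]; [|now apply Hx].
  apply continuous_eq_at; [easy| |easy].
  apply continuity_pt_filterlim, PSeries_continuity. now rewrite Rabs_R0.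
Qed.

(** * Planar curves, inverse functions, rotations *)

Lemma is_derive_fst (f : R -> R * R) (t : R) (l : R * R) :
  is_derive f t l -> is_derive (fun s => fst (f s)) t (fst l).
Proof.
  intros H.
  exact (filterdiff_comp' f fst t _ fst H (filterdiff_linear _ is_linear_fst)).
Qed.

Lemma is_derive_snd (f : R -> R * R) (t : R) (l : R * R) :
  is_derive f t l -> is_derive (fun s => snd (f s)) t (snd l).
Proof.
  intros H.
  exact (filterdiff_comp' f snd t _ snd H (filterdiff_linear _ is_linear_snd)).
Qed.

Lemma is_linear_inl : is_linear (fun x : R => (x, 0)).
Proof.
  split.
  - intros x y. apply (f_equal (pair _)). symmetry. apply Rplus_0_r.
  - intros k x. apply (f_equal (pair _)). symmetry. apply Rmult_0_r.
  - exists 1. split; [lra|]. intros x.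
    change (sqrt (Rabs x ^ 2 + Rabs 0 ^ 2) <= 1 * Rabs x).
    rewrite Rabs_R0. replace (Rabs x ^ 2 + 0 ^ 2) with (Rsqr (Rabs x)).
    + rewrite sqrt_Rsqr by apply Rabs_pos. lra.
    + unfold Rsqr. ring.
Qed.

Lemma is_linear_inr : is_linear (fun x : R => (0, x)).
Proof.
  split.
  - intros x y. apply (f_equal (fun a => (a, _))). symmetry. apply Rplus_0_r.
  - intros k x. apply (f_equal (fun a => (a, _))). symmetry. apply Rmult_0_r.
  - exists 1. split; [lra|]. intros x.
    change (sqrt (Rabs 0 ^ 2 + Rabs x ^ 2) <= 1 * Rabs x).
    rewrite Rabs_R0. replace (0 ^ 2 + Rabs x ^ 2) with (Rsqr (Rabs x)).
    + rewrite sqrt_Rsqr by apply Rabs_pos. lra.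
    + unfold Rsqr. ring.
Qed.

(** A pair is the sum of its images under the two linear injections of the axes. *)
Lemma is_derive_pair (f g : R -> R) (t lf lg : R) :
  is_derive f t lf -> is_derive g t lg ->
  is_derive (fun s => (f s, g s)) t (lf, lg).
Proof.
  intros Hf Hg.
  pose proof (filterdiff_comp' f (fun x : R => (x, 0)) t _ _ Hf
    (filterdiff_linear _ is_linear_inl)) as H1.
  pose proof (filterdiff_comp' g (fun x : R => (0, x)) t _ _ Hg
    (filterdiff_linear _ is_linear_inr)) as H2.
  pose proof (filterdiff_plus_fct _ _ _ _ H1 H2) as H3.
  eapply filterdiff_ext_lin.
  - eapply filterdiff_ext with (2 := H3). intros s.
    apply injective_projections; [apply Rplus_0_r | apply Rplus_0_l].
  - intros s. apply injective_projections; [apply Rplus_0_r | apply Rplus_0_l].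
Qed.

(** * Mean value estimates and inverse functions *)

Lemma Rabs_MVT (f f' : R -> R) (a b : R) :
  (forall x, Rmin a b <= x <= Rmax a b -> is_derive f x (f' x)) ->
  exists c, Rmin a b <= c <= Rmax a b /\
    Rabs (f b - f a) = Rabs (f' c) * Rabs (b - a).
Proof.
  intros Hf. destruct (MVT_gen f a b f') as [c [Hc Heq]].
  - intros x Hx. apply Hf. lra.
  - intros x Hx. apply continuity_pt_filterlim, @ex_derive_continuous.
    eexists. now apply Hf.
  - exists c. split; [exact Hc|]. now rewrite Heq, Rabs_mult.
Qed.

Lemma Rabs_segment_lt (a b c d : R) :
  Rabs a < d -> Rabs b < d -> Rmin a b <= c <= Rmax a b -> Rabs c < d.
Proof.
  intros Ha Hb Hc. apply Rabs_def2 in Ha, Hb. apply Rabs_def1.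
  - apply Rle_lt_trans with (1 := proj2 Hc). now apply Rmax_lub_lt.
  - apply Rlt_le_trans with (2 := proj1 Hc). now apply Rmin_glb_lt.
Qed.

Lemma cos_lipschitz (a b : R) : Rabs (cos b - cos a) <= Rabs (b - a).
Proof.
  destruct (Rabs_MVT cos (fun x => - sin x) a b) as [c [_ ->]].
  - intros x _. apply is_derive_cos.
  - rewrite Rabs_Ropp. pose proof (SIN_bound c) as Hs.
    apply Rabs_le in Hs. pose proof (Rabs_pos (b - a)). nra.
Qed.

Lemma sin_lipschitz (a b : R) : Rabs (sin b - sin a) <= Rabs (b - a).
Proof.
  destruct (Rabs_MVT sin cos a b) as [c [_ ->]].
  - intros x _. apply is_derive_sin.
  - pose proof (COS_bound c) as Hs.
    apply Rabs_le in Hs. pose proof (Rabs_pos (b - a)). nra.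
Qed.

(** Expansion by the factor c makes the inverse Lipschitz with constant 1 / c; this supplies the
    continuity needed to differentiate it. It is applied to [g] on an interval and to the time
    function on the whole line. *)
Lemma inverse_of_expansive (f : R -> R) (I J : R -> Prop) (c : R) :
  0 < c -> open J ->
  (forall x y, I x -> I y -> c * Rabs (x - y) <= Rabs (f x - f y)) ->
  (forall y, J y -> exists x, I x /\ f x = y) ->
  exists g : R -> R, forall y, J y ->
    I (g y) /\ f (g y) = y /\
    forall l, l <> 0 -> is_derive f (g y) l -> is_derive g y (/ l).
Proof.
  intros Hc HJ Hexp Hsurj.
  assert (Hg : exists g : R -> R, forall y, J y -> I (g y) /\ f (g y) = y).
  { exists (fun y => epsilon (inhabits 0) (fun x => I x /\ f x = y)).
    intros y Hy. apply epsilon_spec. now apply Hsurj. }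
  destruct Hg as [g Hg]. exists g. intros y Hy.
  split; [now apply Hg|]. split; [now apply Hg|]. intros l Hl Hd.
  assert (Hlip : forall y', J y' -> Rabs (g y' - g y) <= / c * Rabs (y' - y)).
  { intros y' Hy'.
    pose proof (Hexp (g y') (g y) (proj1 (Hg _ Hy')) (proj1 (Hg _ Hy))) as E.
    rewrite (proj2 (Hg _ Hy')), (proj2 (Hg _ Hy)) in E.
    apply Rmult_le_reg_l with c; [easy|].
    rewrite <- Rmult_assoc, Rinv_r by lra. lra. }
  apply is_derive_Reals. apply is_derive_Reals in Hd.
  intros e He.
  (* With k the increment of the inverse, k / s - 1 / l = - (s / k - l) * (k / s) / l and |k / s| <=
     1 / c; an error below e * c * |l| in s / k therefore suffices. Taking |s| < c * del forces |k|
     < del. *)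
  set (e' := Rmin (Rabs l / 2) (e * c * Rabs l)).
  pose proof (Rabs_pos_lt l Hl) as Hl0.
  assert (He' : 0 < e').
  { apply Rmin_pos; [lra|]. repeat apply Rmult_lt_0_compat; easy. }
  destruct (Hd e' He') as [del Hdel]. destruct (HJ y Hy) as [r Hr].
  assert (Hm : 0 < Rmin r (c * del)).
  { apply Rmin_pos; [apply cond_pos|].
    apply Rmult_lt_0_compat; [easy|apply cond_pos]. }
  exists (mkposreal _ Hm). intros s Hs0 Hs. simpl in Hs.
  assert (Hsr : Rabs s < r) by (eapply Rlt_le_trans; [exact Hs|apply Rmin_l]).
  assert (Hsc : Rabs s < c * del)
    by (eapply Rlt_le_trans; [exact Hs|apply Rmin_r]).
  assert (HJs : J (y + s)).
  { apply Hr. change (Rabs (y + s - y) < r).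
    now replace (y + s - y) with s by ring. }
  pose proof (Hlip _ HJs) as Hk. replace (y + s - y) with s in Hk by ring.
  set (k := g (y + s) - g y) in *.
  assert (Hfk : f (g y + k) - f (g y) = s).
  { unfold k. replace (g y + (g (y + s) - g y)) with (g (y + s)) by ring.
    rewrite (proj2 (Hg _ HJs)), (proj2 (Hg _ Hy)). ring. }
  assert (Hk0 : k <> 0).
  { intros E. rewrite E in Hfk. rewrite Rplus_0_r in Hfk. lra. }
  assert (Hkd : Rabs k < del).
  { apply Rle_lt_trans with (1 := Hk). apply Rmult_lt_reg_l with c; [easy|].
    rewrite <- Rmult_assoc, Rinv_r by lra. lra. }
  specialize (Hdel k Hk0 Hkd). rewrite Hfk in Hdel.
  replace (k / s - / l) with (- (s / k - l) * (k / s) * / l)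
    by (field; repeat split; easy).
  rewrite !Rabs_mult, Rabs_Ropp, Rabs_inv.
  assert (Hks : Rabs (k / s) <= / c).
  { unfold Rdiv. rewrite Rabs_mult, Rabs_inv.
    pose proof (Rabs_pos_lt s Hs0).
    apply Rmult_le_reg_r with (Rabs s); [easy|].
    rewrite Rmult_assoc, Rinv_l by lra. lra. }
  assert (Hlt : Rabs (s / k - l) < e * c * Rabs l)
    by (eapply Rlt_le_trans; [exact Hdel|apply Rmin_r]).
  apply Rle_lt_trans with (Rabs (s / k - l) * / c * / Rabs l).
  - apply Rmult_le_compat_r; [left; now apply Rinv_0_lt_compat|].
    apply Rmult_le_compat_l; [apply Rabs_pos|easy].
  - apply Rmult_lt_reg_r with (c * Rabs l); [now apply Rmult_lt_0_compat|].
    replace (Rabs (s / k - l) * / c * / Rabs l * (c * Rabs l))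
      with (Rabs (s / k - l)) by (field; lra). lra.
Qed.

Lemma IVT_incr_value (f : R -> R) (a b y : R) :
  a < b -> (forall x, a <= x <= b -> continuous f x) -> f a < y < f b ->
  exists x, a <= x <= b /\ f x = y.
Proof.
  intros Hab Hf Hy.
  destruct (IVT_interv (fun x => f x - y) a b) as [x [Hx Hx0]].
  - intros x Hx. apply continuity_pt_minus.
    + apply continuity_pt_filterlim. now apply Hf.
    + apply continuity_pt_const. now intros ? ?.
  - easy.
  - lra.
  - lra.
  - exists x. split; [easy|lra].
Qed.

(** * Rotations of the plane *)

Lemma is_derive_0_const (f : R -> R) :
  (forall t, is_derive f t 0) -> forall s t, f s = f t.
Proof.
  intros H.
  assert (K : forall s t, s < t -> f s = f t).
  { intros s t Hst. apply (eq_is_derive f s t); [|easy]. intros u _. apply H. }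
  intros s t. destruct (Rtotal_order s t) as [Hst|[->|Hst]]; [auto|easy|].
  symmetry. now apply K.
Qed.

(** Turning (a, b) back by the angle t gives a pair with zero derivative, hence a constant one. *)
Lemma rotation_flow (a b : R -> R) :
  (forall t, is_derive a t (- b t)) -> (forall t, is_derive b t (a t)) ->
  forall t, a t = a 0 * cos t - b 0 * sin t /\
            b t = a 0 * sin t + b 0 * cos t.
Proof.
  intros Ha Hb.
  assert (Ea : forall t, Derive (fun x => a x) t = - b t)
    by (intros t; now apply is_derive_unique).
  assert (Eb : forall t, Derive (fun x => b x) t = a t)
    by (intros t; now apply is_derive_unique).
  assert (ex_a : forall t, ex_derive a t) by (intros t; eexists; apply Ha).
  assert (ex_b : forall t, ex_derive b t) by (intros t; eexists; apply Hb).
  assert (H1 : forall t, is_derive (fun t => a t * cos t + b t * sin t) t 0).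
  { intros t. auto_derive; [now repeat split|]. rewrite Ea, Eb. ring. }
  assert (H2 : forall t, is_derive (fun t => b t * cos t - a t * sin t) t 0).
  { intros t. auto_derive; [now repeat split|]. rewrite Ea, Eb. ring. }
  intros t.
  pose proof (is_derive_0_const _ H1 t 0) as E1.
  pose proof (is_derive_0_const _ H2 t 0) as E2.
  cbv beta in E1, E2. rewrite cos_0, sin_0 in E1, E2.
  pose proof (sin2_cos2 t) as Hsc. unfold Rsqr in Hsc.
  replace (a 0) with (a t * cos t + b t * sin t) by lra.
  replace (b 0) with (b t * cos t - a t * sin t) by lra.
  split.
  - transitivity (a t * (sin t * sin t + cos t * cos t)); [rewrite Hsc|]; ring.
  - transitivity (b t * (sin t * sin t + cos t * cos t)); [rewrite Hsc|]; ring.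
Qed.

Lemma cos_lt_1 (t : R) : 0 < t < 2 * PI -> cos t < 1.
Proof.
  intros Ht. replace t with (2 * (t / 2)) by field. rewrite cos_2a_sin.
  pose proof (sin_gt_0 (t / 2) ltac:(lra) ltac:(lra)). nra.
Qed.

(** The inner product of a vector with its displacement under the rotation by t is its squared
    length times 1 - cos t. *)
Lemma rotation_fixed (a b t : R) :
  cos t < 1 -> a = a * cos t - b * sin t -> b = a * sin t + b * cos t ->
  a = 0 /\ b = 0.
Proof.
  intros Hc Ha Hb.
  assert (E : (a * a + b * b) * (1 - cos t) = 0).
  { transitivity (a * (a - (a * cos t - b * sin t)) +
      b * (b - (a * sin t + b * cos t))); [ring|]. rewrite <- Ha, <- Hb. ring. }
  apply Rmult_integral in E. destruct E as [E|E]; [nra|lra].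
Qed.

(** [acos (u / r)] fixes the angle up to sign, and the sign of v decides. *)
Lemma polar_coordinates (u v : R) :
  0 < u ^ 2 + v ^ 2 ->
  exists s, u = sqrt (u ^ 2 + v ^ 2) * cos s /\
            v = sqrt (u ^ 2 + v ^ 2) * sin s.
Proof.
  intros Hp. set (r := sqrt (u ^ 2 + v ^ 2)).
  assert (Hr : 0 < r) by now apply sqrt_lt_R0.
  assert (Hr2 : r * r = u ^ 2 + v ^ 2) by (apply sqrt_sqrt; lra).
  assert (Hur : -1 <= u / r <= 1).
  { split; apply Rmult_le_reg_r with r; try easy;
      unfold Rdiv; rewrite Rmult_assoc, Rinv_l by lra; nra. }
  assert (Hcos : cos (acos (u / r)) = u / r) by (apply cos_acos; lra).
  assert (Hsin : sin (acos (u / r)) * r = Rabs v).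
  { assert (Hs0 : 0 <= sin (acos (u / r))).
    { destruct (acos_bound (u / r)). now apply sin_ge_0. }
    pose proof (sin2_cos2 (acos (u / r))) as E. unfold Rsqr in E.
    apply Rsqr_inj; [nra|apply Rabs_pos|]. rewrite <- Rsqr_abs. unfold Rsqr.
    rewrite Hcos in E.
    replace (v * v) with (r * r - u * u) by (rewrite Hr2; ring).
    transitivity (r * r * (1 - u / r * (u / r))); [nra|]. field. lra. }
  destruct (Rle_or_lt 0 v) as [Hv|Hv].
  - exists (acos (u / r)). rewrite Hcos. split; [field; lra|].
    rewrite Rabs_pos_eq in Hsin by easy. lra.
  - exists (- acos (u / r)). rewrite cos_neg, sin_neg, Hcos.
    split; [field; lra|]. rewrite Rabs_left in Hsin by easy. lra.
Qed.

(** * The system in normal form *)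

Section Dynamics.

Context (d M : R) (q0 h h' p k H : R -> R).
Context (d_pos : 0 < d) (M_pos : 0 < M).
Context (dq0 : forall x, Rabs x < d -> is_derive q0 x (1 - p x * q0 x)).
Context (dh : forall x, Rabs x < d -> is_derive h x (h' x)).
Context (dH : forall x, Rabs x < d -> is_derive H x (h x)).
Context (dk : forall x, Rabs x < d -> is_derive k x (p x * k x)).
Context (k_ge : forall x, Rabs x < d -> 1 / 2 <= k x).
Context (h_le : forall x, Rabs x < d -> Rabs (h x) <= M).
Context (q0_0 : q0 0 = 0).

(* [b] ensures |h y| <= 1/2; [m] keeps the curves [energy = r ^ 2] with [r < m]
   inside the box and makes the linearization injective there (2 m M < 1/2). *)
Let b := / (2 * M).
Let m := Rmin (d / 4) (b / 4).

Definition normal_field (z : R * R) : R * R :=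
  let (x, y) := z in
  (- y, q0 x + 3 * (h x * q0 x) * y
        + (3 * h x ^ 2 * q0 x + p x) * y ^ 2
        + (h x ^ 3 * q0 x - h' x + h x * p x) * y ^ 3).

Let g (x : R) : R := q0 x * k x.
Let vel (z : R * R) : R := k (fst z) * snd z / (1 + h (fst z) * snd z).
Let energy (z : R * R) : R := g (fst z) ^ 2 + vel z ^ 2.
Let box (z : R * R) : Prop := Rabs (fst z) < d /\ Rabs (snd z) < b.
Let nbhd (z : R * R) : Prop := box z /\ energy z < m ^ 2.

(* [(lin_re z, lin_im z)] is [(g, vel)] rotated by the angle [H]. *)
Let lin_re (z : R * R) : R :=
  g (fst z) * cos (H (fst z)) - vel z * sin (H (fst z)).
Let lin_im (z : R * R) : R :=
  g (fst z) * sin (H (fst z)) + vel z * cos (H (fst z)).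

Lemma box_size_pos : 0 < b.
Proof. apply Rinv_0_lt_compat. lra. Qed.

Lemma mult_box_size : M * b = 1 / 2.
Proof. unfold b. field. lra. Qed.

Lemma energy_bound_pos : 0 < m.
Proof. pose proof box_size_pos. apply Rmin_pos; lra. Qed.

Lemma energy_bound_le : m <= d / 4 /\ m <= b / 4.
Proof. split; [apply Rmin_l|apply Rmin_r]. Qed.

Lemma box_denominator (z : R * R) :
  box z -> 1 / 2 <= 1 + h (fst z) * snd z <= 3 / 2.
Proof.
  intros [Hx Hy]. pose proof (h_le _ Hx) as Hh.
  assert (E : Rabs (h (fst z) * snd z) <= 1 / 2).
  { rewrite Rabs_mult, <- mult_box_size.
    apply Rmult_le_compat; auto using Rabs_pos. lra. }
  apply Rabs_le_between in E. lra.
Qed.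

Lemma is_derive_g (x : R) : Rabs x < d -> is_derive g x (k x).
Proof.
  intros Hx. unfold g. evar_last.
  - apply (is_derive_mult q0 k x _ _ (dq0 x Hx) (dk x Hx)). apply Rmult_comm.
  - change ((1 - p x * q0 x) * k x + q0 x * (p x * k x) = k x). ring.
Qed.

Lemma g_expansive (x y : R) :
  Rabs x < d -> Rabs y < d -> 1 / 2 * Rabs (x - y) <= Rabs (g x - g y).
Proof.
  intros Hx Hy. destruct (Rabs_MVT g k y x) as [c [Hc ->]].
  - intros t Ht. apply is_derive_g. now apply (Rabs_segment_lt y x).
  - pose proof (k_ge c (Rabs_segment_lt y x c d Hy Hx Hc)) as Hk.
    rewrite (Rabs_pos_eq (k c)) by lra. pose proof (Rabs_pos (x - y)). nra.
Qed.

Lemma H_lipschitz (x y : R) :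
  Rabs x < d -> Rabs y < d -> Rabs (H x - H y) <= M * Rabs (x - y).
Proof.
  intros Hx Hy. destruct (Rabs_MVT H h y x) as [c [Hc ->]].
  - intros t Ht. apply dH. now apply (Rabs_segment_lt y x).
  - pose proof (h_le c (Rabs_segment_lt y x c d Hy Hx Hc)).
    pose proof (Rabs_pos (x - y)). nra.
Qed.

Lemma g_0 : g 0 = 0.
Proof. unfold g. rewrite q0_0. ring. Qed.

Lemma Rabs_0_lt_d : Rabs 0 < d.
Proof. now rewrite Rabs_R0. Qed.

Lemma fst_le_g (x : R) : Rabs x < d -> Rabs x <= 2 * Rabs (g x).
Proof.
  intros Hx. pose proof (g_expansive x 0 Hx Rabs_0_lt_d) as E.
  rewrite g_0, !Rminus_0_r in E. lra.
Qed.

(** The constant 3 is the upper bound 3/2 of the denominator divided by the lower bound 1/2 of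
    [k]. *)
Lemma snd_le_vel (z : R * R) : box z -> Rabs (snd z) <= 3 * Rabs (vel z).
Proof.
  intros Hz. pose proof (box_denominator z Hz) as Hd.
  pose proof (k_ge _ (proj1 Hz)) as Hk. unfold vel, Rdiv.
  rewrite !Rabs_mult, Rabs_inv, (Rabs_pos_eq (k _)),
    (Rabs_pos_eq (1 + _)) by lra.
  set (D := 1 + h (fst z) * snd z) in *.
  pose proof (Rabs_pos (snd z)) as Hy.
  apply Rmult_le_reg_r with D; [lra|].
  replace (3 * (k (fst z) * Rabs (snd z) * / D) * D)
    with (3 * k (fst z) * Rabs (snd z)) by (field; lra).
  nra.
Qed.

(** For fixed x, [vel] is a Moebius function of y; with w = vel / k its inverse is w / (1 - h w).
    The same formula produces the curve in [orbit_exists]. *)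
Lemma snd_of_vel (z : R * R) :
  box z ->
  snd z = vel z / k (fst z) / (1 - h (fst z) * (vel z / k (fst z))).
Proof.
  intros Hz. pose proof (box_denominator z Hz) as Hd.
  pose proof (k_ge _ (proj1 Hz)) as Hk. unfold vel.
  field. split; [|lra].
  replace (1 + h (fst z) * snd z - h (fst z) * snd z) with 1 by ring.
  repeat split; lra.
Qed.

Lemma energy_lin (z : R * R) : energy z = lin_re z ^ 2 + lin_im z ^ 2.
Proof.
  unfold energy, lin_re, lin_im.
  pose proof (sin2_cos2 (H (fst z))) as E. unfold Rsqr in E.
  set (s := sin (H (fst z))) in *. set (c := cos (H (fst z))) in *.
  transitivity ((g (fst z) ^ 2 + vel z ^ 2) * (s * s + c * c));
    [rewrite E|]; ring.
Qed.

Lemma g_lin (z : R * R) :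
  g (fst z) = lin_re z * cos (H (fst z)) + lin_im z * sin (H (fst z)).
Proof.
  unfold lin_re, lin_im.
  pose proof (sin2_cos2 (H (fst z))) as E. unfold Rsqr in E.
  set (s := sin (H (fst z))) in *. set (c := cos (H (fst z))) in *.
  transitivity (g (fst z) * (s * s + c * c)); [rewrite E|]; ring.
Qed.

Lemma vel_lin (z : R * R) :
  vel z = lin_im z * cos (H (fst z)) - lin_re z * sin (H (fst z)).
Proof.
  unfold lin_re, lin_im.
  pose proof (sin2_cos2 (H (fst z))) as E. unfold Rsqr in E.
  set (s := sin (H (fst z))) in *. set (c := cos (H (fst z))) in *.
  transitivity (vel z * (s * s + c * c)); [rewrite E|]; ring.
Qed.

(** Equal images are one vector with components at most m, turned back by the two angles H (fst z)
    and H (fst w). The values of g thus differ by at most 2 m M |x - x'| <= |x - x'| / 4, while g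
    expands by at least 1/2; so x = x'. Then the angles agree, hence [vel], hence y. *)
Lemma lin_injective (z w : R * R) :
  nbhd z -> nbhd w -> lin_re z = lin_re w -> lin_im z = lin_im w -> z = w.
Proof.
  intros [Hz Fz] [Hw _] Ere Eim.
  pose proof energy_bound_pos as Hm. pose proof energy_bound_le as [_ Hmb].
  pose proof mult_box_size as HMb.
  rewrite energy_lin in Fz.
  assert (Hre : Rabs (lin_re z) <= m) by (apply Rabs_le; split; nra).
  assert (Him : Rabs (lin_im z) <= m) by (apply Rabs_le; split; nra).
  assert (Efst : fst z = fst w).
  { pose proof (g_expansive _ _ (proj1 Hz) (proj1 Hw)) as E1.
    pose proof (H_lipschitz _ _ (proj1 Hz) (proj1 Hw)) as E2.
    assert (E3 : Rabs (g (fst z) - g (fst w)) <=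
      2 * m * Rabs (H (fst z) - H (fst w))).
    { rewrite (g_lin z), (g_lin w), <- Ere, <- Eim.
      replace (_ - _) with
        (lin_re z * (cos (H (fst z)) - cos (H (fst w))) +
         lin_im z * (sin (H (fst z)) - sin (H (fst w)))) by ring.
      apply Rle_trans with (1 := Rabs_triang _ _). rewrite !Rabs_mult.
      pose proof (cos_lipschitz (H (fst w)) (H (fst z))).
      pose proof (sin_lipschitz (H (fst w)) (H (fst z))).
      apply Rle_trans with (m * Rabs (H (fst z) - H (fst w)) +
        m * Rabs (H (fst z) - H (fst w))); [|lra].
      apply Rplus_le_compat; apply Rmult_le_compat; auto using Rabs_pos. }
    apply Rminus_diag_uniq. apply NNPP. intros Hne.
    pose proof (Rabs_pos_lt _ Hne).
    assert (2 * m * M <= 1 / 4) by nra.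
    assert (2 * m * Rabs (H (fst z) - H (fst w)) <=
      2 * m * (M * Rabs (fst z - fst w))) by (apply Rmult_le_compat_l; lra).
    nra. }
  apply injective_projections; [exact Efst|].
  rewrite (snd_of_vel z Hz), (snd_of_vel w Hw), (vel_lin z), (vel_lin w).
  now rewrite Ere, Eim, Efst.
Qed.

(** The coefficients are made for this cancellation: the second component of the field is q0 (1 + h
    y)^3 + p y^2 (1 + h y) - h' y^3. In the quotient rule the derivatives of k and h remove the last
    two terms. *)
Lemma vel_derive (x y : R -> R) (t : R) :
  box (x t, y t) ->
  is_derive (fun s => (x s, y s)) t (normal_field (x t, y t)) ->
  is_derive (fun s => vel (x s, y s)) t
    ((1 + h (x t) * y t) * g (x t)).
Proof.
  intros Hbox Hd.
  pose proof (is_derive_fst _ _ _ Hd) as dx. simpl in dx.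
  pose proof (is_derive_snd _ _ _ Hd) as dy. simpl in dy.
  pose proof (box_denominator _ Hbox) as HD. simpl in HD.
  destruct Hbox as [Hx _]. simpl in Hx.
  pose proof (k_ge _ Hx) as Hk.
  pose proof (dk _ Hx) as Dk. pose proof (dh _ Hx) as Dh.
  unfold vel, g. simpl.
  auto_derive.
  - repeat split; try lra; eexists; eassumption.
  - rewrite (is_derive_unique (fun s : R => x s) t _ dx),
      (is_derive_unique (fun s : R => y s) t _ dy),
      (is_derive_unique (fun s : R => k s) (x t) _ Dk),
      (is_derive_unique (fun s : R => h s) (x t) _ Dh).
    field. lra.
Qed.

Lemma lin_derive (gamma : R -> R * R) (t : R) :
  box (gamma t) -> is_derive gamma t (normal_field (gamma t)) ->
  is_derive (fun s => lin_re (gamma s)) t (- lin_im (gamma t)) /\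
  is_derive (fun s => lin_im (gamma s)) t (lin_re (gamma t)).
Proof.
  intros Hbox Hd.
  set (x := fun s => fst (gamma s)). set (y := fun s => snd (gamma s)).
  assert (Eg : forall s, gamma s = (x s, y s))
    by (intros s; apply surjective_pairing).
  rewrite Eg in Hbox, Hd.
  assert (Hd' : is_derive (fun s => (x s, y s)) t (normal_field (x t, y t))).
  { now apply is_derive_ext with gamma. }
  pose proof (is_derive_fst _ _ _ Hd') as dx. simpl in dx.
  pose proof (vel_derive x y t Hbox Hd') as dv.
  pose proof (box_denominator _ Hbox) as HD. simpl in HD.
  assert (Hx : Rabs (x t) < d) by apply Hbox.
  pose proof (k_ge _ Hx) as Hk.
  (* Naming [v] lets [auto_derive] treat it as a function with the known derivative [dv], so the
     quotient is not differentiated again. *)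
  set (v := fun s => vel (x s, y s)) in dv.
  assert (Ev : v t = k (x t) * y t / (1 + h (x t) * y t)) by reflexivity.
  pose proof (is_derive_g _ Hx) as Dg. pose proof (dH _ Hx) as DH.
  split.
  - apply is_derive_ext with
      (fun s => g (x s) * cos (H (x s)) - v s * sin (H (x s))).
    { intros s. now rewrite Eg. }
    rewrite Eg.
    replace (lin_im (x t, y t)) with
      (g (x t) * sin (H (x t)) + v t * cos (H (x t))) by reflexivity.
    auto_derive.
    + repeat split; eexists; eassumption.
    + rewrite (is_derive_unique (fun s : R => x s) t _ dx),
        (is_derive_unique (fun s : R => v s) t _ dv),
        (is_derive_unique (fun s : R => g s) (x t) _ Dg),
        (is_derive_unique (fun s : R => H s) (x t) _ DH), Ev.
      field. lra.
  - apply is_derive_ext with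
      (fun s => g (x s) * sin (H (x s)) + v s * cos (H (x s))).
    { intros s. now rewrite Eg. }
    rewrite Eg.
    replace (lin_re (x t, y t)) with
      (g (x t) * cos (H (x t)) - v t * sin (H (x t))) by reflexivity.
    auto_derive.
    + repeat split; eexists; eassumption.
    + rewrite (is_derive_unique (fun s : R => x s) t _ dx),
        (is_derive_unique (fun s : R => v s) t _ dv),
        (is_derive_unique (fun s : R => g s) (x t) _ Dg),
        (is_derive_unique (fun s : R => H s) (x t) _ DH), Ev.
      field. lra.
Qed.

Lemma origin_in_nbhd : nbhd (0, 0).
Proof.
  pose proof energy_bound_pos. pose proof box_size_pos.
  split; [split; simpl; now rewrite Rabs_R0|].
  unfold energy, vel. simpl. rewrite g_0.
  replace (0 * (0 * 1) + _) with 0.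
  - nra.
  - unfold Rdiv. ring.
Qed.

Lemma lin_origin : lin_re (0, 0) = 0 /\ lin_im (0, 0) = 0.
Proof.
  unfold lin_re, lin_im, vel. simpl. rewrite g_0. unfold Rdiv. split; ring.
Qed.

Lemma nbhd_energy_0 (z : R * R) : nbhd z -> energy z = 0 -> z = (0, 0).
Proof.
  intros Hz E. rewrite energy_lin in E. destruct lin_origin as [E1 E2].
  apply lin_injective; [easy|apply origin_in_nbhd| |].
  - rewrite E1. nra.
  - rewrite E2. nra.
Qed.

(** * Orbits that stay in the neighbourhood, and their period *)

Section Orbit.
Context (gamma : R -> R * R).
Context (gamma_nbhd : forall t, nbhd (gamma t)).
Context (gamma_sol : forall t, is_derive gamma t (normal_field (gamma t))).

Lemma orbit_rotation (s t : R) :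
  lin_re (gamma (s + t)) =
    lin_re (gamma s) * cos t - lin_im (gamma s) * sin t /\
  lin_im (gamma (s + t)) =
    lin_re (gamma s) * sin t + lin_im (gamma s) * cos t.
Proof.
  assert (L : forall t,
    is_derive (fun t => lin_re (gamma (s + t))) t (- lin_im (gamma (s + t))) /\
    is_derive (fun t => lin_im (gamma (s + t))) t (lin_re (gamma (s + t)))).
  { intros u.
    destruct (lin_derive gamma (s + u) (proj1 (gamma_nbhd _)) (gamma_sol _))
      as [L1 L2].
    assert (D : is_derive (fun u => s + u) u 1) by (auto_derive; lra).
    split; evar_last.
    - apply (is_derive_comp (fun r => lin_re (gamma r)) (fun u => s + u)
        u _ _ L1 D).
    - apply (scal_one (V := R_ModuleSpace)).
    - apply (is_derive_comp (fun r => lin_im (gamma r)) (fun u => s + u)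
        u _ _ L2 D).
    - apply (scal_one (V := R_ModuleSpace)). }
  pose proof (rotation_flow _ _ (fun t => proj1 (L t)) (fun t => proj2 (L t)) t)
    as E.
  cbv beta in E. now rewrite Rplus_0_r in E.
Qed.

Lemma orbit_energy (s t : R) : energy (gamma s) = energy (gamma t).
Proof.
  rewrite !energy_lin. replace s with (t + (s - t)) by ring.
  destruct (orbit_rotation t (s - t)) as [-> ->].
  pose proof (sin2_cos2 (s - t)) as E. unfold Rsqr in E.
  set (A := lin_re (gamma t)). set (B := lin_im (gamma t)).
  set (c := cos (s - t)) in *. set (r := sin (s - t)) in *.
  transitivity ((A ^ 2 + B ^ 2) * (r * r + c * c)); [ring|rewrite E; ring].
Qed.

(** The linearized orbit returns after 2 pi, and injectivity on [nbhd] transfers this to [gamma]. *)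
Lemma orbit_periodic : periodic gamma (2 * PI).
Proof.
  pose proof PI_RGT_0. split; [lra|]. intros t.
  destruct (orbit_rotation t (2 * PI)) as [E1 E2].
  rewrite cos_2PI, sin_2PI in E1, E2.
  apply lin_injective; auto; lra.
Qed.

(** A period S < 2 pi would give a rotation with cos S < 1 fixing the linearized point, which would
    then be 0. *)
Lemma orbit_least_period :
  energy (gamma 0) <> 0 -> least_period gamma (2 * PI).
Proof.
  intros H0. split; [exact orbit_periodic|]. intros S [HS Hper].
  apply Rnot_lt_le. intros HS2. apply H0.
  destruct (orbit_rotation 0 S) as [E1 E2]. rewrite (Hper 0) in E1, E2.
  destruct (rotation_fixed _ _ S (cos_lt_1 S ltac:(lra)) E1 E2) as [F1 F2].
  rewrite energy_lin, F1, F2. ring.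
Qed.

(** Zero energy pins the orbit to the origin, and a constant orbit has no least period because half
    of any period is again a period. *)
Lemma orbit_least_period_unique (S : R) :
  least_period gamma S -> S = 2 * PI.
Proof.
  intros [[HS Hper] Hmin].
  destruct (Req_dec (energy (gamma 0)) 0) as [E|E].
  - assert (Hc : forall t, gamma t = (0, 0)).
    { intros t. apply nbhd_energy_0; [easy|]. now rewrite (orbit_energy t 0). }
    assert (HS2 : periodic gamma (S / 2)).
    { split; [lra|]. intros t. now rewrite !Hc. }
    specialize (Hmin _ HS2). lra.
  - destruct (orbit_least_period E) as [Hp Hl].
    apply Rle_antisym; [now apply Hmin|]. now apply Hl.
Qed.

End Orbit.

(** * Construction of the orbit on each level curve *)

Lemma g_growth (x y : R) :
  Rabs x < d -> Rabs y < d -> x < y -> (y - x) / 2 <= g y - g x.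
Proof.
  intros Hx Hy Hxy. destruct (MVT_gen g x y k) as [c [Hc ->]].
  - intros t Ht. apply is_derive_g. apply (Rabs_segment_lt x y); [easy..|lra].
  - intros t Ht. apply continuity_pt_filterlim, @ex_derive_continuous.
    eexists. apply is_derive_g. now apply (Rabs_segment_lt x y).
  - pose proof (k_ge c (Rabs_segment_lt x y c d Hx Hy Hc)). nra.
Qed.

Lemma g_inverse :
  exists ginv : R -> R, forall u, Rabs u < m ->
    Rabs (ginv u) < d /\ g (ginv u) = u /\ is_derive ginv u (/ k (ginv u)).
Proof.
  pose proof energy_bound_pos as Hm. pose proof energy_bound_le as [Hmd _].
  destruct (inverse_of_expansive g (fun x => Rabs x < d) (fun u => Rabs u < m)
    (1 / 2)) as [ginv Hginv].
  - lra.
  - apply open_Rabs_lt.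
  - exact g_expansive.
  - intros u Hu. apply Rabs_def2 in Hu.
    assert (H2m : forall x, -(2 * m) <= x <= 2 * m -> Rabs x < d).
    { intros x Hx. apply Rabs_def1; lra. }
    (* Since g' = k >= 1/2, g reaches m at 2 m and -m at -2 m; these endpoints lie in the domain
       because 2 m <= d / 2. *)
    destruct (IVT_incr_value g (- (2 * m)) (2 * m) u) as [x [Hx E]].
    + lra.
    + intros x Hx. apply @ex_derive_continuous. eexists.
      apply is_derive_g. now apply H2m.
    + pose proof (g_growth 0 (2 * m) Rabs_0_lt_d
        (H2m (2 * m) ltac:(lra)) ltac:(lra)) as G1.
      pose proof (g_growth (- (2 * m)) 0 (H2m (- (2 * m)) ltac:(lra))
        Rabs_0_lt_d ltac:(lra)) as G2.
      rewrite g_0 in G1, G2. lra.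
    + exists x. split; [now apply H2m|exact E].
  - exists ginv. intros u Hu. destruct (Hginv u Hu) as [H1 [H2 H3]].
    split; [easy|split; [easy|]]. apply H3; [|now apply is_derive_g].
    pose proof (k_ge _ H1). lra.
Qed.

(** On a solution the linearized point turns at unit speed. A point whose pair (g, vel) has angle s
    has linearized angle s + H(x), so this sum is the right choice of time. *)
Lemma orbit_exists (r : R) :
  0 < r < m ->
  exists gamma : R -> R * R,
    (forall t, box (gamma t) /\ energy (gamma t) = r ^ 2) /\
    (forall t, is_derive gamma t (normal_field (gamma t))) /\
    (forall z, box z -> energy z = r ^ 2 -> exists t, gamma t = z).
Proof.
  intros Hr. pose proof energy_bound_le as [Hmd Hmb].
  pose proof mult_box_size as HMb.
  destruct g_inverse as [ginv Hginv].
  (* The curve is parametrized by the angle [s], with [g = r cos s] and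
     [vel = r sin s]; its time is [tau s = s + H (x s)]. *)
  assert (Hrc : forall s, Rabs (r * cos s) < m).
  { intros s. rewrite Rabs_mult, (Rabs_pos_eq r) by lra.
    apply Rle_lt_trans with (r * 1); [|lra].
    apply Rmult_le_compat_l; [lra|]. apply Rabs_le, COS_bound. }
  set (x := fun s => ginv (r * cos s)).
  assert (Hx : forall s, Rabs (x s) < d) by (intros s; now apply Hginv).
  assert (Hgx : forall s, g (x s) = r * cos s) by (intros s; now apply Hginv).
  assert (Hk : forall s, 1 / 2 <= k (x s)) by (intros s; now apply k_ge).
  (* [w] stands for vel / k, and y is recovered from it as w / (1 - h w). As 2 r M stays below 1/2,
     the denominator is at least 1/2; it is also the derivative of [tau]. *)
  set (w := fun s => r * sin s / k (x s)).
  assert (Hw : forall s, Rabs (w s) <= 2 * r).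
  { intros s. unfold w, Rdiv. rewrite Rabs_mult, Rabs_inv.
    specialize (Hk s). rewrite (Rabs_pos_eq (k (x s))) by lra.
    apply Rmult_le_reg_r with (k (x s)); [lra|].
    rewrite Rmult_assoc, Rinv_l by lra. rewrite Rmult_1_r.
    rewrite Rabs_mult, (Rabs_pos_eq r) by lra.
    pose proof (Rabs_le (sin s) 1 (SIN_bound s)). nra. }
  assert (Hhw : forall s, 1 / 2 <= 1 - h (x s) * w s).
  { intros s. pose proof (h_le _ (Hx s)).
    assert (E : Rabs (h (x s) * w s) <= M * (2 * r)).
    { rewrite Rabs_mult. apply Rmult_le_compat; auto using Rabs_pos. }
    apply Rabs_le_between in E. nra. }
  assert (dx : forall s, is_derive x s (- w s)).
  { intros s. unfold x. evar_last.
    - apply (is_derive_comp ginv (fun s => r * cos s)).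
      + now apply Hginv.
      + auto_derive; [easy|reflexivity].
    - unfold w, scal. specialize (Hk s). simpl. unfold mult. simpl.
      fold (x s). field. lra. }
  set (tau := fun s => s + H (x s)).
  assert (dtau : forall s, is_derive tau s (1 - h (x s) * w s)).
  { intros s. pose proof (dx s) as D1. pose proof (dH _ (Hx s)) as D2.
    unfold tau. auto_derive.
    - repeat split; eexists; eassumption.
    - rewrite (is_derive_unique (fun s : R => x s) s _ D1),
        (is_derive_unique (fun s : R => H s) (x s) _ D2). ring. }
  assert (tau_exp : forall s t, 1 / 2 * Rabs (s - t) <= Rabs (tau s - tau t)).
  { intros s t.
    destruct (Rabs_MVT tau _ t s (fun u _ => dtau u)) as [c [_ ->]].
    specialize (Hhw c). rewrite (Rabs_pos_eq (1 - _)) by lra.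
    pose proof (Rabs_pos (s - t)). nra. }
  assert (tau_inj : forall s t, tau s = tau t -> s = t).
  { intros s t E. pose proof (tau_exp s t) as E1.
    rewrite E, Rminus_diag, Rabs_R0 in E1. apply Rminus_diag_uniq.
    apply NNPP. intros Hne. apply Rabs_pos_lt in Hne. lra. }
  destruct (inverse_of_expansive tau (fun _ => True) (fun _ => True) (1 / 2))
    as [sigma Hsigma].
  { lra. }
  { apply open_true. }
  { intros s t _ _. apply tau_exp. }
  (* C strictly bounds |H (x s)| for every s, so tau (t - C) < t < tau (t + C) and t is attained. *)
  { intros t _. set (C := Rabs (H 0) + M * d + 1).
    assert (HC : forall s, Rabs (H (x s)) < C).
    { intros s. pose proof (H_lipschitz _ _ (Hx s) Rabs_0_lt_d) as E.
      rewrite Rminus_0_r in E.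
      pose proof (Rabs_triang_inv (H (x s)) (H 0)). specialize (Hx s).
      unfold C. nra. }
    assert (C_pos : 0 < C).
    { specialize (HC 0). pose proof (Rabs_pos (H (x 0))). lra. }
    destruct (IVT_incr_value tau (t - C) (t + C) t) as [s [_ Hs]].
    - lra.
    - intros s _. apply @ex_derive_continuous. eexists. apply dtau.
    - unfold tau. pose proof (Rabs_def2 _ _ (HC (t - C))).
      pose proof (Rabs_def2 _ _ (HC (t + C))). lra.
    - now exists s. }
  set (y := fun s => w s / (1 - h (x s) * w s)).
  (* Here 1 + h y = 1 / (1 - h w). Dividing this derivative by that of [tau] gives (q0 + p w^2 - h'
     w^3) / (1 - h w)^3, the second component of the field. *)
  assert (dy : forall s, is_derive y s
    ((q0 (x s) + p (x s) * w s ^ 2 - h' (x s) * w s ^ 3) /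
     (1 - h (x s) * w s) ^ 2)).
  { intros s. specialize (Hhw s). specialize (Hk s).
    pose proof (dx s) as D1. pose proof (dh _ (Hx s)) as D2.
    pose proof (dk _ (Hx s)) as D3.
    unfold y, w. unfold w in Hhw. auto_derive.
    - repeat split; try (eexists; eassumption); lra.
    - rewrite (is_derive_unique (fun s : R => x s) s _ D1),
        (is_derive_unique (fun s : R => h s) (x s) _ D2),
        (is_derive_unique (fun s : R => k s) (x s) _ D3).
      replace (cos s) with (q0 (x s) * k (x s) / r)
        by (specialize (Hgx s); unfold g in Hgx; rewrite Hgx; field; lra).
      unfold w. field. repeat split; try lra.
      intros E. apply (Rlt_not_eq 0 (1 - h (x s) * (r * sin s / k (x s))));
        [lra|].
      transitivity ((k (x s) - h (x s) * (r * sin s)) / k (x s));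
        [rewrite E; field; lra | field; lra]. }
  assert (vel_xy : forall s, vel (x s, y s) = r * sin s).
  { intros s. specialize (Hhw s). specialize (Hk s).
    transitivity (k (x s) * w s); [|unfold w; field; lra].
    unfold vel, y. simpl. field. split; [lra|].
    replace (1 - h (x s) * w s + h (x s) * w s) with 1 by ring. lra. }
  (* The bound on y is |y| <= 2 |w| <= 4 r < 4 m <= b. *)
  assert (box_xy : forall s, box (x s, y s)).
  { intros s. split; simpl; [easy|].
    specialize (Hhw s). specialize (Hw s). unfold y, Rdiv.
    rewrite Rabs_mult, Rabs_inv, (Rabs_pos_eq (1 - _)) by lra.
    apply Rle_lt_trans with (Rabs (w s) * 2); [|lra].
    apply Rmult_le_compat_l; [apply Rabs_pos|].
    rewrite <- (Rinv_inv 2). apply Rinv_le_contravar; lra. }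
  exists (fun t => (x (sigma t), y (sigma t))). split; [|split].
  - intros t. split; [apply box_xy|].
    unfold energy. rewrite vel_xy. simpl fst. rewrite Hgx.
    pose proof (sin2_cos2 (sigma t)) as E. unfold Rsqr in E.
    transitivity (r ^ 2 * (sin (sigma t) * sin (sigma t) +
      cos (sigma t) * cos (sigma t))); [ring|]. rewrite E. ring.
  - intros t. destruct (Hsigma t I) as [_ [_ Hd]].
    pose proof (Hhw (sigma t)) as Hden.
    specialize (Hd (1 - h (x (sigma t)) * w (sigma t))
      ltac:(apply Rgt_not_eq; lra) (dtau (sigma t))).
    evar_last.
    + apply is_derive_pair.
      * apply (is_derive_comp x sigma t _ _ (dx _) Hd).
      * apply (is_derive_comp y sigma t _ _ (dy _) Hd).
    + unfold normal_field, scal. simpl. unfold mult. simpl. unfold y.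
      set (s := sigma t) in *. apply f_equal2.
      * field. lra.
      * field. lra.
  - intros z Hz E.
    (* The polar angle s of (g, vel) identifies the point of the curve, which is reached at time
       [tau s]. *)
    destruct (polar_coordinates (g (fst z)) (vel z)) as [s [E1 E2]].
    { change (0 < energy z). rewrite E. nra. }
    change (g (fst z) ^ 2 + vel z ^ 2) with (energy z) in E1, E2.
    rewrite E, sqrt_pow2 in E1, E2 by lra.
    exists (tau s). destruct (Hsigma (tau s) I) as [_ [Hs _]].
    apply tau_inj in Hs. rewrite Hs.
    assert (Efst : x s = fst z).
    { apply Rminus_diag_uniq. apply NNPP. intros Hne. apply Rabs_pos_lt in Hne.
      pose proof (g_expansive _ _ (Hx s) (proj1 Hz)) as E3.
      rewrite Hgx, <- E1, Rminus_diag, Rabs_R0 in E3. lra. }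
    apply injective_projections; [exact Efst|].
    rewrite (snd_of_vel z Hz), E2, <- Efst. reflexivity.
Qed.

(** * Level curves surround the origin *)

Lemma locally_box (z : R * R) : box z -> locally z box.
Proof.
  intros [Hx Hy].
  apply (locally_open (fun z => Rabs (fst z) < d /\ Rabs (snd z) < b));
    [|easy|easy].
  apply open_and.
  - apply (open_comp fst (fun x => Rabs x < d)); [|apply open_Rabs_lt].
    intros w _. destruct w. apply continuous_fst.
  - apply (open_comp snd (fun y => Rabs y < b)); [|apply open_Rabs_lt].
    intros w _. destruct w. apply continuous_snd.
Qed.

Lemma continuous_energy (z : R * R) : box z -> continuous energy z.
Proof.
  intros Hz. pose proof (box_denominator z Hz) as HD.
  destruct z as [x y]. simpl in HD. pose proof (proj1 Hz : Rabs x < d) as Hx.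
  assert (Hfst : forall f l, is_derive f x l ->
    continuity_2d_pt (fun u _ => f u) x y).
  { intros f l Hf. apply (continuity_1d_2d_pt_comp f (fun u _ => u)).
    - apply continuity_pt_filterlim, @ex_derive_continuous. now exists l.
    - apply continuity_2d_pt_id1. }
  pose proof (Hfst _ _ (is_derive_g x Hx)) as Cg.
  pose proof (Hfst _ _ (dk x Hx)) as Ck.
  pose proof (Hfst _ _ (dh x Hx)) as Ch.
  assert (Cvel : continuity_2d_pt
    (fun u v => k u * v * / (1 + h u * v)) x y).
  { apply continuity_2d_pt_mult; [|apply continuity_2d_pt_inv; [|simpl; lra]].
    - apply continuity_2d_pt_mult; [easy|apply continuity_2d_pt_id2].
    - apply continuity_2d_pt_plus; [apply continuity_2d_pt_const|].
      apply continuity_2d_pt_mult; [easy|apply continuity_2d_pt_id2]. }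
  assert (Ce : continuity_2d_pt (fun u v => g u * g u +
    k u * v * / (1 + h u * v) * (k u * v * / (1 + h u * v))) x y).
  { apply continuity_2d_pt_plus; apply continuity_2d_pt_mult; easy. }
  apply continuity_2d_pt_filterlim in Ce.
  assert (Ee : forall w, g (fst w) * g (fst w) +
    k (fst w) * snd w * / (1 + h (fst w) * snd w) *
    (k (fst w) * snd w * / (1 + h (fst w) * snd w)) = energy w).
  { intros w. unfold energy, vel, Rdiv. ring. }
  unfold continuous. rewrite <- Ee.
  apply filterlim_ext with (2 := Ce). exact Ee.
Qed.

Lemma locally_energy (P : R -> Prop) (z : R * R) :
  open P -> box z -> P (energy z) -> locally z (fun w => box w /\ P (energy w)).
Proof.
  intros HP Hz Hpz. apply filter_and; [now apply locally_box|].
  apply (continuous_energy z Hz). now apply HP.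
Qed.

(** Off the curve the plane is covered by two disjoint open sets, lower energy inside the box and
    everything else. A connected set through the origin that misses the curve lies in the first,
    which is bounded. *)
Lemma level_curve_surrounds (r : R) (gamma : R -> R * R) :
  0 < r < m ->
  (forall t, energy (gamma t) = r ^ 2) ->
  (forall z, box z -> energy z = r ^ 2 -> exists t, gamma t = z) ->
  surrounds gamma (0, 0).
Proof.
  intros Hr He Hcov. pose proof energy_bound_le as [Hmd Hmb].
  pose proof box_size_pos as Hb.
  assert (E0 : energy (0, 0) = 0).
  { rewrite energy_lin. destruct lin_origin as [-> ->]. ring. }
  assert (Hr2 : 0 < r ^ 2) by nra.
  split.
  { intros t E. specialize (He t). rewrite E, E0 in He. lra. }
  exists (d + b). intros z [C [HC [HCs [HC0 HCz]]]].
  set (A := fun z => box z /\ energy z < r ^ 2).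
  set (B := fun z => (box z /\ r ^ 2 < energy z) \/
    (d / 2 < Rabs (fst z) \/ 3 / 4 * b < Rabs (snd z))).
  (* From |x| <= 2 |g| and |y| <= 3 |vel| with r < m, the region of energy at most r ^ 2 keeps a
     distance from the edge of the box. The outer part of [B] can thus be open and still contain the
     complement of the box. *)
  assert (Hsmall : forall z, box z -> energy z <= r ^ 2 ->
    Rabs (fst z) <= d / 2 /\ Rabs (snd z) <= 3 / 4 * b).
  { intros w Hw Hle. unfold energy in Hle.
    pose proof (fst_le_g _ (proj1 Hw)). pose proof (snd_le_vel w Hw).
    assert (Rabs (g (fst w)) <= r) by (apply Rabs_le; split; nra).
    assert (Rabs (vel w) <= r) by (apply Rabs_le; split; nra).
    lra. }
  assert (HA : open A).
  { intros w [Hw1 Hw2]. apply (locally_energy (fun e => e < r ^ 2)); try easy.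
    apply open_lt. }
  assert (HB : open B).
  { apply open_or; [|apply open_or].
    - intros w [Hw1 Hw2]. apply (locally_energy (fun e => r ^ 2 < e)); try easy.
      apply open_gt.
    - apply (open_comp (fun w : R * R => Rabs (fst w)) (fun x => d / 2 < x)).
      + intros w _. destruct w.
        apply (continuous_comp fst Rabs);
          [apply continuous_fst | apply continuous_Rabs].
      + apply open_gt.
    - apply (open_comp (fun w : R * R => Rabs (snd w)) (fun y => 3 / 4 * b < y)).
      + intros w _. destruct w.
        apply (continuous_comp snd Rabs);
          [apply continuous_snd | apply continuous_Rabs].
      + apply open_gt. }
  assert (HAz : A z).
  { destruct (HC A B HA HB) as [K|K].
    - intros w Hw. destruct (classic (box w)) as [Hbw|Hbw].
      + destruct (Rtotal_order (energy w) (r ^ 2)) as [Hlt|[Heq|Hgt]].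
        * now left.
        * destruct (Hcov w Hbw Heq) as [t Ht]. now destruct (HCs w Hw t).
        * right. now left.
      + right. right. apply NNPP. intros Hn. apply Hbw. split; lra.
    - intros w _ [[Hw1 Hw2] HBw].
      destruct (Hsmall w Hw1 ltac:(lra)). destruct HBw as [[_ ?]|[?|?]]; lra.
    - now apply K.
    - destruct (K _ HC0) as [[_ K0]|[K0|K0]]; simpl in K0.
      + lra.
      + rewrite Rabs_R0 in K0. lra.
      + rewrite Rabs_R0 in K0. lra. }
  destruct HAz as [[Hz1 Hz2] _]. destruct z as [x y]. simpl in Hz1, Hz2.
  change (sqrt (Rabs x ^ 2 + Rabs y ^ 2) <= d + b).
  pose proof (Rabs_pos x). pose proof (Rabs_pos y).
  rewrite <- (sqrt_pow2 (d + b)) by lra. apply sqrt_le_1_alt. nra.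
Qed.

(** The orbit built through a point of [nbhd] keeps its energy and stays in the box, so [nbhd]
    serves both for the center and for the common period. *)
Lemma normal_form_isochronous (U : R * R -> Prop) (V : R * R -> R * R) :
  (forall z, Rabs (fst z) < d -> U z) ->
  (forall z, Rabs (fst z) < d -> V z = normal_field z) ->
  isochronous_center U V (0, 0).
Proof.
  intros HU HV. pose proof Rabs_0_lt_d as H0d.
  assert (Hnb : locally (0, 0) nbhd).
  { destruct origin_in_nbhd as [H1 H2].
    apply (locally_energy (fun e => e < m ^ 2)); [apply open_lt|easy|easy]. }
  split.
  - split; [now apply HU|]. split.
    { rewrite HV by easy. unfold normal_field. rewrite q0_0.
      apply f_equal2; ring. }
    exists nbhd. split; [exact Hnb|]. intros z Hz Hz0.
    assert (Hpos : 0 < energy z).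
    { destruct (Rle_or_lt (energy z) 0) as [Hle|]; [|easy].
      destruct Hz0. apply nbhd_energy_0; [easy|].
      unfold energy in *. nra. }
    set (r := sqrt (energy z)).
    assert (Er : r ^ 2 = energy z) by (apply pow2_sqrt; lra).
    assert (Hr : 0 < r < m).
    { pose proof energy_bound_pos. destruct Hz as [_ Hz].
      assert (0 < r) by now apply sqrt_lt_R0. split; nra. }
    destruct (orbit_exists r Hr) as [gamma [Hg [Hsol Hcov]]].
    assert (Hgn : forall t, nbhd (gamma t)).
    { intros t. destruct (Hg t) as [G1 G2]. split; [easy|].
      rewrite G2, Er. apply Hz. }
    exists gamma, (2 * PI). split; [split|split; [|split]].
    + intros t. destruct (Hg t) as [[G1 _] _]. split; [now apply HU|].
      now rewrite HV.
    + apply orbit_least_period; [easy|easy|].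
      rewrite (proj2 (Hg 0)). lra.
    + apply Hcov; [apply Hz|easy].
    + exact Hgn.
    + apply (level_curve_surrounds r); [easy| |easy]. intros t. apply Hg.
  - exists nbhd, (2 * PI). split; [exact Hnb|].
    intros gamma S [Hsol Hper] Hgn.
    apply (orbit_least_period_unique gamma); [easy| |easy].
    intros t. destruct (Hsol t) as [_ Hd]. rewrite HV in Hd; [easy|].
    apply Hgn.
Qed.

End Dynamics.

(** * Division by q0 *)

Lemma analytic_on_div_id (D : R -> Prop) (f phi : R -> R) :
  open D -> smooth_on D phi -> (forall x, f x = x * phi x) ->
  analytic_on D f -> analytic_on D phi.
Proof.
  intros HD Hphi Hf Ha a Da. destruct (Req_dec a 0) as [->|Ha0].
  - apply analytic_at_div_id with f; auto.
    now apply (smooth_on_continuous D).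
  - apply analytic_at_ext_loc with (fun x => f x * / (0 + 1 * x)).
    + generalize (open_neq 0 a Ha0). apply filter_imp. intros x Hx.
      rewrite Hf. field. lra.
    + apply analytic_at_mult; [now apply Ha|].
      apply analytic_at_inv; [lra|apply analytic_at_affine].
Qed.

(** Both functions are divided by x. The quotient q / x has no zero: its value at 0 is the
    derivative of q there, and elsewhere q itself does not vanish. *)
Lemma smooth_on_quotient (D : R -> Prop) (q f : R -> R) :
  open D -> D 0 -> smooth_on D q -> q 0 = 0 -> Derive q 0 <> 0 ->
  (forall x, D x -> q x = 0 -> x = 0) -> smooth_on D f -> f 0 = 0 ->
  exists h, smooth_on D h /\ (forall x, D x -> h x * q x = f x) /\
    (analytic_on D q -> analytic_on D f -> analytic_on D h).
Proof.
  intros HD D0 Hq q_0 dq_0 q_zero Hf f_0.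
  destruct (smooth_on_div_id D q HD D0 Hq q_0) as [e [He Eq]].
  destruct (smooth_on_div_id D f HD D0 Hf f_0) as [phi [Hphi Ef]].
  assert (e_neq_0 : forall x, D x -> e x <> 0).
  { intros x Dx E. destruct (Req_dec x 0) as [->|Hx].
    - apply dq_0. rewrite (Derive_ext _ _ _ Eq).
      rewrite Derive_mult, Derive_id, E; [ring|apply ex_derive_id|].
      now apply (smooth_on_ex_derive D).
    - apply Hx. apply q_zero; [easy|]. rewrite Eq, E. ring. }
  exists (fun x => phi x * / e x). split; [|split].
  - apply smooth_on_mult; [easy..|]. now apply smooth_on_inv.
  - intros x Dx. rewrite Eq, Ef. field. now apply e_neq_0.
  - intros Aq Af a Da. apply analytic_at_mult.
    + apply (analytic_on_div_id D f); easy.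
    + apply analytic_at_inv; [now apply e_neq_0|].
      apply (analytic_on_div_id D q); easy.
Qed.

Lemma smooth_on_mult_cancel (D : R -> Prop) (q f g : R -> R) :
  open D -> (forall x, D x -> q x = 0 -> x = 0) ->
  smooth_on D f -> smooth_on D g ->
  (forall x, D x -> f x * q x = g x * q x) -> forall x, D x -> f x = g x.
Proof.
  intros HD q_zero Hf Hg E.
  assert (Hoff : forall x, D x -> x <> 0 -> f x = g x).
  { intros x Dx Hx. apply Rmult_eq_reg_r with (q x); [now apply E|].
    intros Hq. apply Hx. now apply q_zero. }
  intros x Dx. destruct (Req_dec x 0) as [->|Hx]; [|now apply Hoff].
  apply continuous_eq_at; try now apply (smooth_on_continuous D).
  generalize (HD 0 Dx). apply filter_imp. exact Hoff.
Qed.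

Lemma RInt_antiderivative (d : R) (f : R -> R) (x : R) :
  (forall x, Rabs x < d -> continuous f x) -> Rabs x < d ->
  is_derive (RInt f 0) x (f x).
Proof.
  intros Hf Hx. apply is_derive_RInt with 0; [|now apply Hf].
  generalize (open_Rabs_lt d x Hx). apply filter_imp. intros y Hy.
  apply RInt_correct, @ex_RInt_continuous. intros t Ht. apply Hf.
  apply (Rabs_segment_lt 0 y); [|easy|easy].
  rewrite Rabs_R0. apply Rle_lt_trans with (2 := Hx). apply Rabs_pos.
Qed.

Lemma bigO_at0_square_derive (f : R -> R) :
  bigO_at0 (fun x => f x - x) (fun x => x ^ 2) ->
  f 0 = 0 /\ is_derive f 0 1.
Proof.
  intros [C HC].
  assert (f_0 : f 0 = 0).
  { pose proof (locally_singleton _ _ HC) as E. cbv beta in E.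
    rewrite Rminus_0_r, pow_ne_zero, Rabs_R0, Rmult_0_r in E by easy.
    pose proof (Rabs_pos (f 0)).
    apply NNPP. intros Hn. apply Rabs_pos_lt in Hn. lra. }
  split; [easy|]. apply is_derive_Reals. intros e He.
  destruct HC as [d Hd].
  assert (HC1 : 0 < Rabs C + 1) by (pose proof (Rabs_pos C); lra).
  (* The difference quotient misses 1 by at most |C| |x|; adding 1 to |C| avoids a division by
     zero. *)
  assert (Hm : 0 < Rmin d (e / (Rabs C + 1))).
  { apply Rmin_pos; [apply cond_pos|]. now apply Rdiv_lt_0_compat. }
  exists (mkposreal _ Hm). intros x Hx0 Hx. simpl in Hx.
  assert (Hxd : Rabs x < d) by (eapply Rlt_le_trans; [exact Hx|apply Rmin_l]).
  assert (Hxe : Rabs x < e / (Rabs C + 1))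
    by (eapply Rlt_le_trans; [exact Hx|apply Rmin_r]).
  assert (E : Rabs (f x - x) <= C * Rabs (x ^ 2)).
  { apply Hd. change (Rabs (x - 0) < d). now rewrite Rminus_0_r. }
  rewrite Rplus_0_l, f_0, Rminus_0_r.
  replace (f x / x - 1) with ((f x - x) * / x) by (field; easy).
  pose proof (Rabs_pos_lt x Hx0) as Hxp.
  rewrite Rabs_mult, Rabs_inv.
  apply Rle_lt_trans with (Rabs C * Rabs x).
  - apply Rmult_le_reg_r with (Rabs x); [easy|].
    rewrite Rmult_assoc, Rinv_l, Rmult_1_r by lra.
    rewrite <- RPow_abs in E. pose proof (Rle_abs C).
    apply Rle_trans with (1 := E). simpl. nra.
  - apply Rmult_lt_compat_r with (r := Rabs C + 1) in Hxe; [|easy].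
    unfold Rdiv in Hxe. rewrite Rmult_assoc, Rinv_l in Hxe by lra. nra.
Qed.

Lemma bigO_at0_id (f : R -> R) : bigO_at0 f (fun x => x) -> f 0 = 0.
Proof.
  intros [C HC]. pose proof (locally_singleton _ _ HC) as E. cbv beta in E.
  rewrite Rabs_R0, Rmult_0_r in E. pose proof (Rabs_pos (f 0)).
  apply NNPP. intros Hn. apply Rabs_pos_lt in Hn. lra.
Qed.

Lemma normal_field_isochronous (D : R -> Prop) (q0 h p : R -> R)
  (V : R * R -> R * R) :
  open D -> D 0 -> smooth_on D q0 -> smooth_on D h -> smooth_on D p ->
  q0 0 = 0 -> (forall x, D x -> p x * q0 x = 1 - Derive q0 x) ->
  (forall z, D (fst z) -> V z = normal_field q0 h (Derive h) p z) ->
  isochronous_center (fun z => D (fst z)) V (0, 0).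
Proof.
  intros HD D0 Hq0 Hh Hp q0_0 Ep HV.
  destruct (locally_ball0 D HD D0) as [d0 [d0_pos Hd0]].
  assert (cp : forall x, Rabs x < d0 -> continuous p x).
  { intros x Hx. apply (smooth_on_continuous D); auto. }
  assert (ch : forall x, Rabs x < d0 -> continuous h x).
  { intros x Hx. apply (smooth_on_continuous D); auto. }
  set (k := fun x => exp (RInt p 0 x)).
  assert (dk : forall x, Rabs x < d0 -> is_derive k x (p x * k x)).
  { intros x Hx.
    exact (is_derive_comp exp (RInt p 0) x _ _ (is_derive_exp _)
      (RInt_antiderivative d0 p x cp Hx)). }
  assert (k_0 : k 0 = 1).
  { unfold k. rewrite RInt_point. exact exp_0. }
  assert (R0d : Rabs 0 < d0) by now rewrite Rabs_R0.
  assert (ck : continuous k 0).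
  { apply @ex_derive_continuous. eexists. now apply dk. }
  assert (Lk : locally 0 (fun x => 1 / 2 < k x)).
  { apply (ck (fun u => 1 / 2 < u)). apply open_gt. rewrite k_0. lra. }
  assert (Lh : locally 0 (fun x => Rabs (h x) < Rabs (h 0) + 1)).
  { apply (ch 0 R0d (fun u => Rabs u < Rabs (h 0) + 1)). apply open_Rabs_lt.
    lra. }
  destruct (filter_and _ _ Lk Lh) as [d1 Hd1].
  (* The ball is shrunk until the quantitative bounds hold: k > 1/2 because k 0 = 1, and |h| < |h 0|
     + 1 by continuity. *)
  set (d := Rmin d0 d1).
  assert (Hdd : forall x, Rabs x < d ->
    Rabs x < d0 /\ 1 / 2 < k x /\ Rabs (h x) < Rabs (h 0) + 1).
  { intros x Hx. split.
    - apply Rlt_le_trans with (1 := Hx), Rmin_l.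
    - apply Hd1. change (Rabs (x - 0) < d1). rewrite Rminus_0_r.
      apply Rlt_le_trans with (1 := Hx), Rmin_r. }
  apply (normal_form_isochronous d (Rabs (h 0) + 1) q0 h (Derive h) p k
    (RInt h 0)).
  - apply Rmin_pos; [easy|apply cond_pos].
  - pose proof (Rabs_pos (h 0)). lra.
  - intros x Hx. assert (Dx : D x) by (apply Hd0, Hdd, Hx).
    rewrite Ep by easy.
    replace (1 - (1 - Derive q0 x)) with (Derive q0 x) by ring.
    apply Derive_correct. now apply (smooth_on_ex_derive D).
  - intros x Hx. apply Derive_correct. apply (smooth_on_ex_derive D); [easy|].
    apply Hd0, Hdd, Hx.
  - intros x Hx. apply (RInt_antiderivative d0); [easy|apply Hdd, Hx].
  - intros x Hx. apply dk, Hdd, Hx.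
  - intros x Hx. left. apply Hdd, Hx.
  - intros x Hx. left. apply Hdd, Hx.
  - easy.
  - intros z Hz. apply Hd0, Hdd, Hz.
  - intros z Hz. apply HV, Hd0, Hdd, Hz.
Qed.

Theorem theorem10 (D : R -> Prop) (q0 q1 : R -> R)
  (D_open : open D) (D_0 : D 0)
  (q0_smooth : smooth_on D q0) (q1_smooth : smooth_on D q1)
  (q0_expansion : bigO_at0 (fun x => q0 x - x) (fun x => x ^ 2))
  (q1_expansion : bigO_at0 q1 (fun x => x))
  (q0_only_zero : forall x, D x -> q0 x = 0 -> x = 0) :
  (exists q2 q3 : R -> R,
     smooth_on D q2 /\ smooth_on D q3 /\ relations_on D q0 q1 q2 q3) /\
  (forall q2 q3 p2 p3 : R -> R,
     smooth_on D q2 -> smooth_on D q3 -> relations_on D q0 q1 q2 q3 ->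
     smooth_on D p2 -> smooth_on D p3 -> relations_on D q0 q1 p2 p3 ->
     forall x, D x -> q2 x = p2 x /\ q3 x = p3 x) /\
  (forall q2 q3 : R -> R,
     smooth_on D q2 -> smooth_on D q3 -> relations_on D q0 q1 q2 q3 ->
     (analytic_on D q0 -> analytic_on D q1 ->
        analytic_on D q2 /\ analytic_on D q3) /\
     isochronous_center (fun z => D (fst z)) (cubic_field q0 q1 q2 q3) (0, 0)).
Proof.
  destruct (bigO_at0_square_derive q0 q0_expansion) as [q0_0 dq0_0].
  apply is_derive_unique in dq0_0.
  change (Derive q0 0 = 1) in dq0_0.
  pose proof (bigO_at0_id q1 q1_expansion) as q1_0.
  destruct (smooth_on_quotient D q0 q1 D_open D_0 q0_smooth q0_0
    ltac:(rewrite dq0_0; lra) q0_only_zero q1_smooth q1_0)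
    as [h [Hh [Eh Ah]]].
  destruct (smooth_on_quotient D q0 (fun x => 1 - Derive q0 x) D_open D_0
    q0_smooth q0_0 ltac:(rewrite dq0_0; lra) q0_only_zero
    ltac:(apply smooth_on_minus, smooth_on_Derive; auto using smooth_on_const)
    ltac:(cbv beta; rewrite dq0_0; lra))
    as [p [Hp [Ep Ap]]].
  assert (Hhhq : smooth_on D (fun x => h x * h x * q0 x)).
  { apply smooth_on_mult; [easy| |easy]. now apply smooth_on_mult. }
  set (r2 := fun x => 3 * (h x * h x * q0 x) + p x).
  set (r3 := fun x => h x * (h x * h x * q0 x) - Derive h x + h x * p x).
  assert (Hr2 : smooth_on D r2).
  { apply smooth_on_plus; [easy| |easy].
    apply smooth_on_mult; [easy|apply smooth_on_const|exact Hhhq]. }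
  assert (Hr3 : smooth_on D r3).
  { apply smooth_on_plus; [easy| |now apply smooth_on_mult].
    apply smooth_on_minus; [easy| |now apply smooth_on_Derive].
    now apply smooth_on_mult. }
  (* Differentiating q1 = h q0 brings in h', the source of the term - h' in [r3]. *)
  assert (Dq1 : forall x, D x ->
    Derive q1 x = Derive h x * q0 x + h x * Derive q0 x).
  { intros x Dx. rewrite <- Derive_mult;
      [|now apply (smooth_on_ex_derive D)..].
    apply Derive_ext_loc. generalize (D_open x Dx). apply filter_imp.
    intros t Dt. symmetry. now apply Eh. }
  assert (Hr : relations_on D q0 q1 r2 r3).
  { intros x Dx. unfold r2, r3. rewrite (Dq1 x Dx), <- (Eh x Dx).
    specialize (Ep x Dx).
    replace (Derive q0 x) with (1 - p x * q0 x) by lra. split; ring. }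
  assert (Huniq : forall q2 q3 p2 p3 : R -> R,
     smooth_on D q2 -> smooth_on D q3 -> relations_on D q0 q1 q2 q3 ->
     smooth_on D p2 -> smooth_on D p3 -> relations_on D q0 q1 p2 p3 ->
     forall x, D x -> q2 x = p2 x /\ q3 x = p3 x).
  { intros q2 q3 p2 p3 H2 H3 Hq G2 G3 Hp' x Dx. split.
    - apply (smooth_on_mult_cancel D q0); try easy. intros t Dt.
      now rewrite (proj1 (Hq t Dt)), (proj1 (Hp' t Dt)).
    - apply (smooth_on_mult_cancel D (fun x => q0 x ^ 2)); try easy.
      + intros t Dt E. apply q0_only_zero; [easy|].
        apply NNPP. intros Hn. now apply (pow_nonzero _ 2) in Hn.
      + intros t Dt. now rewrite (proj2 (Hq t Dt)), (proj2 (Hp' t Dt)). }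
  split; [now exists r2, r3|]. split; [exact Huniq|].
  intros q2 q3 H2 H3 Hq.
  (* By uniqueness the given coefficients agree on [D] with the explicit [r2] and [r3], for which
     the remaining claims are checked. *)
  assert (E : forall x, D x -> r2 x = q2 x /\ r3 x = q3 x)
    by (apply Huniq; assumption).
  split.
  - intros Aq0 Aq1. specialize (Ah Aq0 Aq1).
    assert (Ap' : analytic_on D p).
    { apply Ap; [easy|]. intros a Da.
      apply analytic_at_ext_loc with (fun x => (1 + 0 * x) - Derive q0 x).
      - apply filter_forall. intros x. ring.
      - apply analytic_at_minus; [apply analytic_at_affine|].
        now apply analytic_at_Derive, Aq0. }
    assert (Ahhq : analytic_on D (fun x => h x * h x * q0 x)).
    { intros a Da. apply analytic_at_mult; [|now apply Aq0].
      apply analytic_at_mult; now apply Ah. }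
    split; intros a Da.
    + apply analytic_at_ext_loc with r2.
      { generalize (D_open a Da). apply filter_imp. apply E. }
      apply analytic_at_ext_loc with
        (fun x => (3 + 0 * x) * (h x * h x * q0 x) + p x).
      { apply filter_forall. intros x. unfold r2. ring. }
      apply analytic_at_plus; [|now apply Ap'].
      apply analytic_at_mult; [apply analytic_at_affine|now apply Ahhq].
    + apply analytic_at_ext_loc with r3.
      { generalize (D_open a Da). apply filter_imp. apply E. }
      apply analytic_at_plus; [|apply analytic_at_mult; auto].
      apply analytic_at_minus; [|now apply analytic_at_Derive, Ah].
      apply analytic_at_mult; auto.
  - apply (normal_field_isochronous D q0 h p); try easy.
    intros [x y] Dx. simpl in Dx. unfold cubic_field, normal_field.
    destruct (E x Dx) as [<- <-]. rewrite <- (Eh x Dx). unfold r2, r3.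
    apply f_equal2; ring.
Qed.
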